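(* Let $N=1$ and $k\in\mathbb C$. For $c,\lambda\in\mathbb C$, the representation $V_k(c,\lambda)$ of $\mathbb D_k$ is $1$-dimensional if and only if it is one of $$V_k(0,0),\qquad V_k\bigl((k\pm\tfrac32)^2-1,\;k\pm\tfrac12\bigr),\qquad V_k\bigl((k\pm\tfrac52)^2-1,\;k\pm\tfrac32\bigr)$$ (within each expression the signs are the same). These five characters are distinct unless $k\in\{\pm\tfrac12,\pm\tfrac32\}$, when two of them coincide.
   Context: All vector spaces are complex and $\mathbb N=\{0,1,2,\dots\}$. Let $\mathfrak g=\mathfrak g^J_1$ (the complexified Lie algebra of the real Jacobi group of degree $1$ and rank $1$); it has a basis $\tilde H,\tilde E,\tilde F,\tilde e,\tilde f,\tilde Z$ with $[\tilde H,\tilde E]=2\tilde E$, $[\tilde H,\tilde F]=-2\tilde F$, $[\tilde E,\tilde F]=\tilde H$, $[\tilde H,\tilde e]=\tilde e$, $[\tilde H,\tilde f]=-\tilde f$, $[\tilde E,\tilde e]=0$, $[\tilde E,\tilde f]=-\tilde e$, $[\tilde F,\tilde e]=-\tilde f$, $[\tilde F,\tilde f]=0$, $[\tilde e,\tilde f]=-2\tilde Z$, $\tilde Z$ central. Let $\mathfrak k:=\mathrm{Span}\{\tilde H,\tilde Z\}$. For $k\in\mathbb C$, let $\mathcal I_k$ be the left ideal of $\mathfrak U(\mathfrak g)$ generated by $\tilde H-k$ and $\tilde Z+\tfrac12$, and $\mathbb D_k:=\mathfrak U(\mathfrak g)^{\mathfrak k}/(\mathcal I_k\cap\mathfrak U(\mathfrak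 g)^{\mathfrak k})$, where $\mathfrak U(\mathfrak g)^{\mathfrak k}$ is the commutant of $\mathfrak k$ in the universal enveloping algebra (the ideal is two-sided). Equivalently, $\mathbb D_k=A^{\tilde H}/A^{\tilde H}(\tilde H-k)$, where $A:=\mathfrak U(\mathfrak g)/(\tilde Z+\tfrac12)$ and $A^{\tilde H}$ is the commutant of $\tilde H$. In $A$ set $\tilde E_\nu:=\tilde E+\tfrac12\tilde e^2$, $\tilde F_\nu:=\tilde F-\tfrac12\tilde f^2$, $\tilde H_\nu:=\tilde H+\tilde f\tilde e+\tfrac12$. Expressions in these elements that commute with $\tilde H$ are regarded as elements of $\mathbb D_k$. In $\mathbb D_k$ put $\mathcal E:=\tfrac12(\tilde f\tilde e+\tilde e\tilde f)$ and let $\mathcal C_k:=\tilde H_\nu^2+2\tilde H_\nu+4\tilde F_\nu\tilde E_\nu$, which is central. A representation $V$ of $\mathbb D_k$ is admissible if $\mathcal E$ acts semisimply with finite dimensional eigenspaces. $V$ has central character $c$ if $\mathcal C_k$ acts by the scalar $c$. The weights of $V$ are the eigenvalues of $\mathcal E+k$. On each coset $\lambda+2\mathbb Z\subset\mathbb C$ use the order transferred from $2\mathbb Z$, with $-\infty$ and $\infty$ as bottom and top. For $c,\lambda\in\mathbb C$ define $$M^-_k(c,\lambda):=\{-\infty\}\cup\bigl[\{k+\tfrac12,\,k+\tfrac32,\,1\pm\sqrt{c+1}\}\cap(\lambda-2\mathbb N)\bigr],\qquad M^+_k(c,\lambda):=\{\infty\}\cup\bigl[\{k-\tfrac12,\,k-\tfrac32,\,-1\pm\sqrt{c+1}\}\cap(\lambda+2\mathbb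 N)\bigr],$$ and $\Delta_k(c,\lambda):=\{\mu\in\lambda+2\mathbb Z:\max M^-_k(c,\lambda)\le\mu\le\min M^+_k(c,\lambda)\}$. $V_k(c,\lambda)$ denotes the irreducible admissible representation of $\mathbb D_k$, unique up to equivalence, with central character $c$ and set of weights $\Delta_k(c,\lambda)$; every irreducible admissible representation is equivalent to one of these. A character of $\mathbb D_k$ is an algebra homomorphism onto $\mathbb C$, i.e. a $1$-dimensional representation. *)

(* Defs.v *)
From HB Require Import structures.
From mathcomp Require Import all_boot all_order all_algebra.
From mathcomp Require Import boolp classical_sets functions.
From mathcomp Require Import constructive_ereal.
From mathcomp Require Import finmap ring.
From mathcomp.multinomials Require Import -(notations) monalg.

Set Implicit Arguments.
Unset Strict Implicit.
Unset Printing Implicit Defensive.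

Import Order.TTheory GRing.Theory Num.Theory.
Local Open Scope ring_scope.
Local Open Scope quotient_scope.
Local Open Scope classical_set_scope.

(* Proper two-sided ideals; idealr is the library's structure of proper ideals
   stable under left multiplication. *)
Structure ideal2 (A : nzRingType) := Ideal2 {
  ideal2_idealr :> idealr A;
  ideal2Mr : forall a u, u \in (ideal2_idealr : pred A) ->
                         u * a \in (ideal2_idealr : pred A)
}.

Section QuotientAlgebra.
Variables (C : comNzRingType) (A : algType C) (I : ideal2 A).
Local Notation J := (ideal2_idealr I : pred A).

Definition alg_quot : Type := {ideal_quot I}.
HB.instance Definition _ := EqQuotient.on alg_quot.
HB.instance Definition _ := GRing.Zmodule.on alg_quot.

Implicit Types x y z : alg_quot.

Lemma alg_quotP (a b : A) : (\pi_alg_quot a = \pi_alg_quot b) <-> (a - b \in J).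
Proof. by rewrite Quotient.idealrBE; split => [->|/eqP]. Qed.

Definition alg_quot1 : alg_quot := lift_cst alg_quot 1.
Definition alg_quot_mul := lift_op2 alg_quot *%R.
Definition alg_quot_scale (c : C) := lift_op1 alg_quot ( *:%R c).
Canonical pi_alg_quot1_morph := PiConst alg_quot1.

Lemma pi_alg_quot_mul : {morph \pi : x y / x * y >-> alg_quot_mul x y}.
Proof.
move=> x y; unlock alg_quot_mul; apply/alg_quotP.
rewrite -[_ * _](addrNK (x * repr (\pi_alg_quot y))) -mulrBr.
rewrite -addrA -mulrBl rpredD //.
  by rewrite idealMr //; apply/alg_quotP; rewrite reprK.
by rewrite ideal2Mr //; apply/alg_quotP; rewrite reprK.
Qed.
Canonical pi_alg_quot_mul_morph := PiMorph2 pi_alg_quot_mul.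

Lemma pi_alg_quot_scale c :
  {morph \pi : x / c *: x >-> alg_quot_scale c x}.
Proof.
move=> x; unlock alg_quot_scale; apply/alg_quotP.
rewrite -scalerBr -mulr_algl idealMr //; apply/alg_quotP.
by rewrite reprK.
Qed.
Canonical pi_alg_quot_scale_morph c := PiMorph1 (pi_alg_quot_scale c).

Let piD (a b : A) : \pi_alg_quot (a + b) = \pi_alg_quot a + \pi_alg_quot b.
Proof. by rewrite !piE. Qed.

Lemma alg_quot_mulA : associative alg_quot_mul.
Proof. by move=> x y z; rewrite -[x]reprK -[y]reprK -[z]reprK !piE mulrA. Qed.
Lemma alg_quot_mul1 : left_id alg_quot1 alg_quot_mul.
Proof. by move=> x; rewrite -[x]reprK !piE mul1r. Qed.
Lemma alg_quot_mulr1 : right_id alg_quot1 alg_quot_mul.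
Proof. by move=> x; rewrite -[x]reprK !piE mulr1. Qed.
Lemma alg_quot_mulDl : left_distributive alg_quot_mul +%R.
Proof.
by move=> x y z; rewrite -[x]reprK -[y]reprK -[z]reprK -piD -!pi_alg_quot_mul mulrDl piD.
Qed.
Lemma alg_quot_mulDr : right_distributive alg_quot_mul +%R.
Proof.
by move=> x y z; rewrite -[x]reprK -[y]reprK -[z]reprK -piD -!pi_alg_quot_mul mulrDr piD.
Qed.
Lemma alg_quot1_neq0 : alg_quot1 != 0.
Proof. by rewrite piE /Quotient.equiv subr0 idealr1. Qed.
HB.instance Definition _ := GRing.Zmodule_isNzRing.Build alg_quot
  alg_quot_mulA alg_quot_mul1 alg_quot_mulr1 alg_quot_mulDl alg_quot_mulDr
  alg_quot1_neq0.

Lemma alg_quot_scaleA c d x :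
  alg_quot_scale c (alg_quot_scale d x) = alg_quot_scale (c * d) x.
Proof. by rewrite -[x]reprK !piE scalerA. Qed.
Lemma alg_quot_scale1 : left_id 1 alg_quot_scale.
Proof. by move=> x; rewrite -[x]reprK !piE scale1r. Qed.
Lemma alg_quot_scaleDr : right_distributive alg_quot_scale +%R.
Proof.
by move=> c x y; rewrite -[x]reprK -[y]reprK -piD -!pi_alg_quot_scale scalerDr piD.
Qed.
Lemma alg_quot_scaleDl x : {morph alg_quot_scale^~ x : c d / c + d}.
Proof. by move=> c d; rewrite -[x]reprK -!pi_alg_quot_scale scalerDl piD. Qed.
HB.instance Definition _ := GRing.Zmodule_isLmodule.Build C alg_quot
  alg_quot_scaleA alg_quot_scale1 alg_quot_scaleDr alg_quot_scaleDl.

Lemma alg_quot_scaleAl c x y : c *: (x * y) = (c *: x) * y.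
Proof.
rewrite -[x]reprK -[y]reprK /GRing.scale /GRing.mul /=.
by rewrite -!(pi_alg_quot_scale, pi_alg_quot_mul) scalerAl.
Qed.
HB.instance Definition _ := GRing.Lmodule_isLalgebra.Build C alg_quot
  alg_quot_scaleAl.
Lemma alg_quot_scaleAr c x y : c *: (x * y) = x * (c *: y).
Proof.
rewrite -[x]reprK -[y]reprK /GRing.scale /GRing.mul /=.
by rewrite -!(pi_alg_quot_scale, pi_alg_quot_mul) scalerAr.
Qed.
HB.instance Definition _ := GRing.Lalgebra_isAlgebra.Build C alg_quot
  alg_quot_scaleAr.

Definition alg_proj (a : A) : alg_quot := \pi a.

Lemma alg_proj_linear : linear alg_proj.
Proof.
move=> c a b; rewrite /alg_proj piD; congr (_ + _).
exact: pi_alg_quot_scale.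
Qed.
HB.instance Definition _ :=
  GRing.isLinear.Build C A alg_quot *:%R alg_proj alg_proj_linear.

Lemma alg_proj_monoid_morphism : monoid_morphism alg_proj.
Proof.
split=> [|a b]; first by rewrite /alg_proj -[RHS]/alg_quot1 piE.
exact: pi_alg_quot_mul.
Qed.
HB.instance Definition _ :=
  GRing.isMonoidMorphism.Build A alg_quot alg_proj alg_proj_monoid_morphism.

Lemma alg_projD a b : alg_proj (a + b) = alg_proj a + alg_proj b.
Proof. exact: linearD. Qed.
Lemma alg_projN a : alg_proj (- a) = - alg_proj a.
Proof. exact: linearN. Qed.
Lemma alg_projB a b : alg_proj (a - b) = alg_proj a - alg_proj b.
Proof. exact: linearB. Qed.
Lemma alg_projZ c a : alg_proj (c *: a) = c *: alg_proj a.
Proof. exact: linearZ. Qed.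
Lemma alg_proj1 : alg_proj 1 = 1.
Proof. exact: rmorph1. Qed.
Lemma alg_projM a b : alg_proj (a * b) = alg_proj a * alg_proj b.
Proof. exact: rmorphM. Qed.

Lemma alg_proj_eq0 (a : A) : (alg_proj a = 0) <-> (a \in J).
Proof. by rewrite -(linear0 alg_proj) alg_quotP subr0. Qed.

Lemma alg_proj_surj x : exists a, alg_proj a = x.
Proof. by exists (repr x); rewrite /alg_proj reprK. Qed.

End QuotientAlgebra.

Section FreeAlgebra.
Variables (C : comNzRingType) (B : choiceType).

Definition free_alg : Type := malg (fmonom B) C.
HB.instance Definition _ := GRing.Lalgebra.on free_alg.

Lemma malg_scaleAr (c : C) (x y : malg (fmonom B) C) :
  c *: (x * y) = x * (c *: y).
Proof.
apply/malgP => k; rewrite [LHS](mcoeffZ c (x * y)) [in LHS](mcoeffMl x y).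

rewrite (mcoeffMlw k (fsubset_refl (msupp x)) (msuppZ_le c y)) mulr_sumr.
apply: eq_bigr => k1 _; rewrite mulr_sumr; apply: eq_bigr => k2 _.
by rewrite mcoeffZ mulrnAr mulrCA.
Qed.
HB.instance Definition _ := GRing.Lalgebra_isAlgebra.Build C free_alg
  malg_scaleAr.

Definition free_gen (b : B) : free_alg := mkmalgU (fmu b) 1.

Section Action.
Variables (V : lmodType C) (rho : B -> V -> V).
Hypothesis rho_lin : forall b, linear (rho b).

Definition word_act (m : fmonom B) (v : V) : V := foldr rho v m.
Definition free_act (x : free_alg) (v : V) : V :=
  \sum_(m <- enum_fset (msupp x)) mcoeff m x *: word_act m v.

Lemma word_act_linear m : linear (word_act m).
Proof.
by move=> a u v; rewrite /word_act; elim: (fmonom_val m) => //= b s ->; exact: rho_lin.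
Qed.
HB.instance Definition _ m :=
  GRing.isLinear.Build C V V *:%R (word_act m) (word_act_linear m).

Lemma free_actEw (d : {fset fmonom B}) (x : free_alg) v :
  fsubset (msupp x) d ->
  free_act x v = \sum_(m <- enum_fset d) mcoeff m x *: word_act m v.
Proof.
move=> le; rewrite /free_act; apply: (big_fset_incl _ le) => m _.
by move=> /mcoeff_outdom ->; rewrite scale0r.
Qed.

Lemma free_actD x y v : free_act (x + y) v = free_act x v + free_act y v.
Proof.
rewrite (free_actEw _ (msuppD_le x y)).
rewrite (free_actEw _ (fsubsetUl (msupp x) (msupp y))).
rewrite (free_actEw _ (fsubsetUr (msupp x) (msupp y))) -big_split /=.
by apply: eq_bigr => m _; rewrite mcoeffD scalerDl.
Qed.

Lemma free_act0 v : free_act 0 v = 0.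
Proof. by rewrite /free_act big1_seq // => m _; rewrite mcoeff0 scale0r. Qed.

Lemma free_actU c m v : free_act (mkmalgU m c) v = c *: word_act m v.
Proof. by rewrite (free_actEw _ msuppU_le) big_seq_fset1 mcoeffUU. Qed.

Lemma free_actZ c x v : free_act (c *: x) v = c *: free_act x v.
Proof.
rewrite (free_actEw _ (msuppZ_le c x)) /free_act scaler_sumr.
by apply: eq_bigr => m _; rewrite mcoeffZ scalerA.
Qed.

Lemma free_act_gen b v : free_act (free_gen b) v = rho b v.
Proof. by rewrite free_actU scale1r /word_act fmU. Qed.

Lemma free_actN x v : free_act (- x) v = - free_act x v.
Proof. by rewrite -[- x]scaleN1r free_actZ scaleN1r. Qed.

Lemma free_actB x y v : free_act (x - y) v = free_act x v - free_act y v.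
Proof. by rewrite free_actD free_actN. Qed.

Lemma free_act_0r x : free_act x 0 = 0.
Proof. by rewrite /free_act big1 // => m _; rewrite linear0 scaler0. Qed.

Lemma free_act1 v : free_act 1 v = v.
Proof. by rewrite [1]/(mkmalgU _ 1) free_actU scale1r /word_act fm1. Qed.

Lemma free_actM x y v : free_act (x * y) v = free_act x (free_act y v).
Proof.
have actS : {morph free_act^~ v : a b / a + b} by move=> a b; exact: free_actD.
rewrite malgME (big_morph _ actS (free_act0 v)); apply: eq_bigr => m1 _.
rewrite (big_morph _ actS (free_act0 v)) linear_sum scaler_sumr.
apply: eq_bigr => m2 _.
by rewrite free_actU linearZ scalerA /word_act fmM foldr_cat.
Qed.

End Action.
End FreeAlgebra.


Section GeneratedIdeal.
Variable A : nzRingType.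

Inductive gen_ideal (S : A -> Prop) : A -> Prop :=
| gen_ideal_base x of S x : gen_ideal S x
| gen_ideal0 : gen_ideal S 0
| gen_idealD x y of gen_ideal S x & gen_ideal S y : gen_ideal S (x + y)
| gen_idealMl a x of gen_ideal S x : gen_ideal S (a * x)
| gen_idealMr a x of gen_ideal S x : gen_ideal S (x * a).

Variables (S : A -> Prop) (S_proper : ~ gen_ideal S 1).

Definition gen_ideal_pred : pred A := fun x => `[< gen_ideal S x >].

Lemma gen_ideal_closed : idealr_closed gen_ideal_pred.
Proof.
split=> [||a u v /asboolP Su /asboolP Sv]; rewrite ?inE.
- exact/asboolP/gen_ideal0.
- by apply/asboolP.
- by apply/asboolP/gen_idealD => //; apply: gen_idealMl.
Qed.
HB.instance Definition _ := isIdealr.Build A gen_ideal_pred gen_ideal_closed.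

Lemma gen_ideal_predMr a u :
  u \in gen_ideal_pred -> u * a \in gen_ideal_pred.
Proof. by move=> /asboolP Su; apply/asboolP/gen_idealMr. Qed.

Definition ideal_gen_by : ideal2 A :=
  Ideal2 (ideal2_idealr := gen_ideal_pred) gen_ideal_predMr.

End GeneratedIdeal.

(* x lies in the left ideal generated by g and h *)
Definition left_ideal_gen2 (A : nzRingType) (g h x : A) : Prop :=
  exists a b : A, x = a * g + b * h.

Section Commutant.
Variables (C : comNzRingType) (A : algType C) (S : seq A).

Definition commutant : pred A := fun x => all (fun s => s * x == x * s) S.

Lemma commutantP x : reflect {in S, forall s, s * x = x * s} (x \in commutant).
Proof. by apply: (iffP allP) => xS s sS; apply/eqP/xS. Qed.

Lemma commutant_closed : GRing.subsemialg_closed commutant.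
Proof.
split=> [||a x /commutantP xS|x y /commutantP xS /commutantP yS].
- by apply/commutantP => s _; rewrite mulr1 mul1r.
- split=> [|x y /commutantP xS /commutantP yS].
    by apply/commutantP => s _; rewrite mulr0 mul0r.
  by apply/commutantP => s sS; rewrite mulrDr mulrDl xS ?yS.
- by apply/commutantP => s sS; rewrite -scalerAr -scalerAl xS.
- by apply/commutantP => s sS; rewrite mulrA xS // -mulrA yS // mulrA.
Qed.

Definition commutant_alg : Type := {x : A | x \in commutant}.
HB.instance Definition _ := SubChoice.on commutant_alg.
HB.instance Definition _ := GRing.SubChoice_isSubAlgebra.Build C A commutant
  commutant_alg commutant_closed.

Section LeftIdealAct.
Variables (V : lmodType C) (act : A -> V -> V).
Hypotheses (actB : forall x y v, act (x - y) v = act x v - act y v)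
           (actD : forall x y v, act (x + y) v = act x v + act y v)
           (actZ : forall c x v, act (c *: x) v = c *: act x v)
           (act1 : forall v, act 1 v = v) (act0 : forall x, act x 0 = 0)
           (actM : forall x y v, act (x * y) v = act x (act y v)).

Lemma left_ideal_gen2_act (I : ideal2 A) g h c d v :
  (forall x, x \in (ideal2_idealr I : pred A) -> act x v = 0) ->
  act g v = c *: v -> act h v = - (d *: v) ->
  left_ideal_gen2 (alg_proj I g - c *: 1) (alg_proj I h + d *: 1) 1 -> v = 0.
Proof.
move=> I0 gv hv [a [b]].
have [a' <-] := alg_proj_surj a; have [b' <-] := alg_proj_surj b.
rewrite -(alg_proj1 I) -!alg_projZ -!alg_projB -alg_projD -!alg_projM -alg_projD.
move=> /alg_quotP /I0; rewrite actB act1 actD !actM actB actD !actZ !act1 gv hv.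
by rewrite subrr addNr !act0 addr0 subr0.
Qed.
End LeftIdealAct.

Section LeftIdealTrace.
Variables g h : A.
Hypotheses (gS : {in commutant, forall x, g * x = x * g})
           (hS : {in commutant, forall x, h * x = x * h})
           (gh_proper : ~ left_ideal_gen2 g h 1).

(* the intersection of the left ideal with the commutant *)
Definition left_ideal_trace : pred commutant_alg :=
  fun x => `[< left_ideal_gen2 g h (val x) >].

Lemma left_ideal_trace_closed : idealr_closed left_ideal_trace.
Proof.
split=> [||a u v /asboolP[x [y uE]] /asboolP[z [t vE]]]; rewrite ?inE.
- by apply/asboolP; exists 0, 0; rewrite rmorph0 !mul0r addr0.
- by apply/asboolP; exact: gh_proper.
- apply/asboolP; exists (val a * x + z), (val a * y + t).
  by rewrite rmorphD rmorphM /= uE vE mulrDr !mulrA !mulrDl addrACA.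
Qed.
HB.instance Definition _ :=
  isIdealr.Build commutant_alg left_ideal_trace left_ideal_trace_closed.

Lemma left_ideal_traceMr (a u : commutant_alg) :
  u \in left_ideal_trace -> u * a \in left_ideal_trace.
Proof.
move=> /asboolP[x [y uE]]; apply/asboolP; exists (x * val a), (y * val a).
rewrite rmorphM /= uE mulrDl -!mulrA.
by congr (_ * _ + _ * _); [apply: gS|apply: hS]; exact: (valP a).
Qed.

Definition left_ideal_trace2 : ideal2 commutant_alg :=
  Ideal2 (ideal2_idealr := left_ideal_trace) left_ideal_traceMr.
End LeftIdealTrace.
End Commutant.

Section Weight.
Variables (C : comNzRingType) (A : algType C) (h z : A).

(* ad h acts on x by the scalar n, and z commutes with x *)
Definition ad_weight (n : C) (x : A) : Prop :=
  h * x - x * h = n *: x /\ z * x = x * z.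

Lemma ad_weightM m n x y :
  ad_weight m x -> ad_weight n y -> ad_weight (m + n) (x * y).
Proof.
move=> [hx zx] [hy zy]; split; last by rewrite mulrA zx -mulrA zy mulrA.
have -> : h * (x * y) - x * y * h = (h * x - x * h) * y + x * (h * y - y * h).
  by rewrite mulrBl mulrBr !mulrA addrA subrK.
by rewrite hx hy scalerDl -scalerAl -scalerAr.
Qed.

Lemma ad_weightD n x y : ad_weight n x -> ad_weight n y -> ad_weight n (x + y).
Proof.
move=> [hx zx] [hy zy]; split; last by rewrite mulrDl mulrDr zx zy.
by rewrite mulrDl mulrDr opprD addrACA hx hy scalerDr.
Qed.

Lemma ad_weightZ n a x : ad_weight n x -> ad_weight n (a *: x).
Proof.
move=> [hx zx]; rewrite /ad_weight -!scalerAl -!scalerAr zx -scalerBr hx.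
by rewrite !scalerA mulrC.
Qed.

Lemma ad_weight1 : ad_weight 0 1.
Proof. by rewrite /ad_weight !mulr1 !mul1r subrr scale0r. Qed.

Lemma ad_weight0P x : ad_weight 0 x -> x \in commutant [:: h; z].
Proof.
rewrite /ad_weight scale0r => -[/subr0_eq hx zx].
by apply/commutantP => s; rewrite !inE => /orP[] /eqP->.
Qed.

Lemma commutant_subl c :
  {in commutant [:: h; z], forall x, (h - c *: 1) * x = x * (h - c *: 1)}.
Proof.
move=> x /commutantP/(_ h) hx; rewrite mulrBl mulrBr hx ?mem_head //.
by rewrite -scalerAl -scalerAr mul1r mulr1.
Qed.

Lemma commutant_addr c :
  {in commutant [:: h; z], forall x, (z + c *: 1) * x = x * (z + c *: 1)}.
Proof.
move=> x /commutantP/(_ z) zx; rewrite mulrDl mulrDr zx ?inE ?eqxx ?orbT //.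
by rewrite -scalerAl -scalerAr mul1r mulr1.
Qed.
End Weight.

Variant jacobi_basis := jH | jE | jF | je | jf | jZ.

Definition jacobi_code (b : jacobi_basis) : nat :=
  match b with jH => 0 | jE => 1 | jF => 2 | je => 3 | jf => 4 | jZ => 5 end.
Definition jacobi_decode (n : nat) : option jacobi_basis :=
  nth None [:: Some jH; Some jE; Some jF; Some je; Some jf; Some jZ] n.
Lemma jacobi_codeK : pcancel jacobi_code jacobi_decode.
Proof. by case. Qed.
HB.instance Definition _ := Countable.copy jacobi_basis (pcan_type jacobi_codeK).

Section Jacobi.
Variable C : numClosedFieldType.

Local Notation T := (free_alg C jacobi_basis).
Local Notation "''g_' b" := (free_gen C b) (at level 8, b at level 2).
Local Notation "[ 'lie' x , y ]" := (x * y - y * x).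

Definition jacobi_relations : seq T :=
  [:: [lie 'g_jH, 'g_jE] - 2 *: 'g_jE;
      [lie 'g_jH, 'g_jF] + 2 *: 'g_jF;
      [lie 'g_jE, 'g_jF] - 'g_jH;
      [lie 'g_jH, 'g_je] - 'g_je;
      [lie 'g_jH, 'g_jf] + 'g_jf;
      [lie 'g_jE, 'g_je];
      [lie 'g_jE, 'g_jf] + 'g_je;
      [lie 'g_jF, 'g_je] + 'g_jf;
      [lie 'g_jF, 'g_jf];
      [lie 'g_je, 'g_jf] + 2 *: 'g_jZ;
      [lie 'g_jZ, 'g_jH];
      [lie 'g_jZ, 'g_jE];
      [lie 'g_jZ, 'g_jF];
      [lie 'g_jZ, 'g_je];
      [lie 'g_jZ, 'g_jf]].

Section Oscillator.
Variable k : C.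

Local Notation M := (int -> C^o).
(* A U(g)-module on which Z acts by -1/2: e = d/dx and f = x on formal
   combinations of the x^(n - k - 1/2), with E = - e^2/2, F = f^2/2 and
   H = - f e - 1/2. The vector osc_delta below has H-weight k. It shows that
   U(g) and D_k are nonzero, as algType requires. *)
Definition osc_e (g : M) : M := fun n => (n%:~R - k + 2^-1) * g (n + 1).
Definition osc_f (g : M) : M := fun n => g (n - 1).
Definition osc (b : jacobi_basis) (g : M) : M :=
  match b with
  | jH => fun n => - osc_f (osc_e g) n - 2^-1 * g n
  | jE => fun n => - 2^-1 * osc_e (osc_e g) n
  | jF => fun n => 2^-1 * osc_f (osc_f g) n
  | je => osc_e g
  | jf => osc_f g
  | jZ => fun n => - 2^-1 * g n
  end.

Lemma osc_linear b : linear (osc b).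
Proof.
move=> a u v; apply/funext => n.
rewrite -[RHS]/(a * osc b u n + osc b v n).
by case: b => /=; rewrite /osc_e /osc_f -?[(a *: u + v) _]/(a * u _ + v _); ring.
Qed.

Lemma osc_actM x y v :
  free_act osc (x * y) v = free_act osc x (free_act osc y v).
Proof. by apply: free_actM; exact: osc_linear. Qed.

Lemma osc_act0 x : free_act osc x 0 = 0.
Proof. by apply: free_act_0r; exact: osc_linear. Qed.

Lemma osc_relations r v : r \in jacobi_relations -> free_act osc r v = 0.
Proof.
have fD (g h : M) n : (g + h) n = g n + h n by [].
have fN (g : M) n : (- g) n = - g n by [].
have fZ a (g : M) n : (a *: g) n = a * g n by [].
have f0 n : (0 : M) n = 0 by [].
rewrite !inE => rels; apply/funext => n; move: rels.
do 14?[case/orP]; move=> /eqP ->.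
all: rewrite !(free_actD, free_actN, free_actZ, osc_actM, free_act_gen).
all: rewrite ?(fD, fN, fZ) f0 /= /osc_e /osc_f ?(addrK, subrK).
all: rewrite ?(rmorphD, rmorphB, rmorphN) /=.
all: by rewrite ?rmorph1; field.
Qed.

Lemma osc_gen_ideal r v :
  gen_ideal (fun x => x \in jacobi_relations) r -> free_act osc r v = 0.
Proof.
move=> rI; elim: rI v => {r} [r|v|x y _ IHx _ IHy v|a x _ IHx v|a x _ IHx v].
- by move=> rI v; exact: osc_relations.
- exact: free_act0.
- by rewrite free_actD IHx IHy addr0.
- by rewrite free_actM ?IHx ?free_act_0r //; exact: osc_linear.
- by rewrite free_actM ?IHx //; exact: osc_linear.
Qed.

Definition osc_delta : M := fun n => (n == 0)%:R.

Lemma osc_delta_neq0 : osc_delta <> 0.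
Proof. by move=> /(congr1 (@^~ 0)) /eqP; rewrite /osc_delta eqxx oner_eq0. Qed.

Lemma osc_H_delta : osc jH osc_delta = k *: osc_delta.
Proof.
apply/funext => n; rewrite -[RHS]/(k * osc_delta n) /= /osc_e /osc_f subrK.
rewrite /osc_delta; case: eqP => [->|_] /=; last by rewrite !mulr0 oppr0 addr0.
by rewrite rmorphB /=; field.
Qed.

Lemma osc_Z_delta : osc jZ osc_delta = - (2^-1 *: osc_delta).
Proof. by rewrite -scaleNr. Qed.

End Oscillator.

Lemma jacobi_relations_proper :
  ~ gen_ideal (fun x => x \in jacobi_relations) 1.
Proof.
move=> gen1; apply: osc_delta_neq0.
by rewrite -[osc_delta](free_act1 (osc 0)); exact: osc_gen_ideal gen1.
Qed.

(* The universal enveloping algebra: the tensor algebra of g, which is free on a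
   basis of g, modulo the two-sided ideal generated by the x y - y x - [x, y]. *)
Definition UJ : Type := alg_quot (ideal_gen_by jacobi_relations_proper).
HB.instance Definition _ := GRing.Algebra.on UJ.

Definition Ugen (b : jacobi_basis) : UJ := alg_proj _ 'g_b.

Local Notation H := (Ugen jH).
Local Notation E := (Ugen jE).
Local Notation F := (Ugen jF).
Local Notation e := (Ugen je).
Local Notation f := (Ugen jf).
Local Notation Z := (Ugen jZ).

Lemma UJ_relation r :
  r \in jacobi_relations -> alg_proj (ideal_gen_by jacobi_relations_proper) r = 0.
Proof. by move=> rR; apply/alg_proj_eq0/asboolP/gen_ideal_base. Qed.

Let projE := (@alg_projD C T, @alg_projN C T, @alg_projM C T, @alg_projZ C T).

Lemma UJ_relations :
  [/\ H * E - E * H = 2 *: E, H * F - F * H = - (2 *: F), E * F - F * E = H,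
      H * e - e * H = e & H * f - f * H = - f] /\
  [/\ E * e - e * E = 0, E * f - f * E = - e, F * e - e * F = - f,
      F * f - f * F = 0 & e * f - f * e = - (2 *: Z)] /\
  [/\ Z * H - H * Z = 0, Z * E - E * Z = 0, Z * F - F * Z = 0,
      Z * e - e * Z = 0 & Z * f - f * Z = 0].
Proof.
have rel i : (i < 15)%N -> alg_proj (ideal_gen_by jacobi_relations_proper)
    (nth 0 jacobi_relations i) = 0.
  by move=> i15; apply/UJ_relation/mem_nth.
split; last split; split.
- by have := rel 0 isT; rewrite /= !projE => /subr0_eq.
- by have := rel 1 isT; rewrite /= !projE => /eqP; rewrite addr_eq0 => /eqP.
- by have := rel 2 isT; rewrite /= !projE => /subr0_eq.
- by have := rel 3 isT; rewrite /= !projE => /subr0_eq.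
- by have := rel 4 isT; rewrite /= !projE => /eqP; rewrite addr_eq0 => /eqP.
- by have := rel 5 isT; rewrite /= !projE.
- by have := rel 6 isT; rewrite /= !projE => /eqP; rewrite addr_eq0 => /eqP.
- by have := rel 7 isT; rewrite /= !projE => /eqP; rewrite addr_eq0 => /eqP.
- by have := rel 8 isT; rewrite /= !projE.
- by have := rel 9 isT; rewrite /= !projE => /eqP; rewrite addr_eq0 => /eqP.
- by have := rel 10 isT; rewrite /= !projE.
- by have := rel 11 isT; rewrite /= !projE.
- by have := rel 12 isT; rewrite /= !projE.
- by have := rel 13 isT; rewrite /= !projE.
- by have := rel 14 isT; rewrite /= !projE.
Qed.

Lemma UJ_Z b : Z * Ugen b = Ugen b * Z.
Proof.
case: UJ_relations => _ [_ [ZH ZE ZF Ze Zf]].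
case: b; last by [].
- exact: subr0_eq ZH.
- exact: subr0_eq ZE.
- exact: subr0_eq ZF.
- exact: subr0_eq Ze.
- exact: subr0_eq Zf.
Qed.

Definition weight_gen (b : jacobi_basis) : C :=
  match b with jE => 1 + 1 | jF => - 1 - 1 | je => 1 | jf => - 1 | _ => 0 end.

Lemma weight_k_gen b : ad_weight H Z (weight_gen b) (Ugen b).
Proof.
split; last exact: UJ_Z.
case: UJ_relations => -[HE HF _ He Hf] _; case: b => /=.
- by rewrite subrr scale0r.
- exact: HE.
- by rewrite -opprD scaleNr.
- by rewrite scale1r.
- by rewrite scaleNr scale1r.
- by rewrite -UJ_Z subrr scale0r.
Qed.

Definition UJk : Type := commutant_alg [:: H; Z].
HB.instance Definition _ := GRing.Algebra.on UJk.

(* The formulas defining E_nu, F_nu and H_nu in A = U(g)/(Z + 1/2), read in U(g):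
   as Z + 1/2 is central and lies in the left ideal defining D_k, the classes in
   D_k of elements of U(g)^k depend only on their images in A. *)
Definition U_E_nu : UJ := E + 2^-1 *: e ^+ 2.
Definition U_F_nu : UJ := F - 2^-1 *: f ^+ 2.
Definition U_H_nu : UJ := H + f * e + 2^-1 *: 1.
Definition U_calE : UJ := 2^-1 *: (f * e + e * f).
Definition U_calC : UJ := U_H_nu ^+ 2 + 2 *: U_H_nu + 4 *: (U_F_nu * U_E_nu).

Lemma weight_k_fe : ad_weight H Z 0 (f * e).
Proof. by rewrite -(addNr 1); apply: ad_weightM; exact: weight_k_gen. Qed.

Lemma U_calE_commutant : U_calE \in commutant [:: H; Z].
Proof.
apply: ad_weight0P; apply/ad_weightZ/ad_weightD; first exact: weight_k_fe.
by rewrite -(subrr 1); apply: ad_weightM; exact: weight_k_gen.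
Qed.

Lemma weight_k_E_nu : ad_weight H Z (1 + 1) U_E_nu.
Proof.
apply: ad_weightD; first exact: (weight_k_gen jE).
by apply: ad_weightZ; rewrite expr2; apply: ad_weightM; exact: (weight_k_gen je).
Qed.

Lemma weight_k_F_nu : ad_weight H Z (- 1 - 1) U_F_nu.
Proof.
apply: ad_weightD; first exact: (weight_k_gen jF).
rewrite -scaleNr; apply: ad_weightZ; rewrite expr2.
by apply: ad_weightM; exact: (weight_k_gen jf).
Qed.

Lemma weight_k_H_nu : ad_weight H Z 0 U_H_nu.
Proof.
apply: ad_weightD; last exact/ad_weightZ/ad_weight1.
by apply: ad_weightD; [exact: (weight_k_gen jH)|exact: weight_k_fe].
Qed.

Lemma U_calC_commutant : U_calC \in commutant [:: H; Z].
Proof.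
apply: ad_weight0P; apply: ad_weightD.
  apply: ad_weightD; last exact/ad_weightZ/weight_k_H_nu.
  by rewrite expr2 -[0](addr0 0); apply: ad_weightM; exact: weight_k_H_nu.
apply: ad_weightZ; rewrite -(addNr (1 + 1)) opprD.
by apply: ad_weightM; [exact: weight_k_F_nu|exact: weight_k_E_nu].
Qed.

Section DJ.
Variable k : C.

Lemma left_ideal_k_proper :
  ~ left_ideal_gen2 (H - k *: 1) (Z + 2^-1 *: 1) 1.
Proof.
move=> /(@left_ideal_gen2_act _ _ _ (free_act (osc k))) H1.
apply: osc_delta_neq0; apply: H1.
- exact: free_actB.
- exact: free_actD.
- exact: free_actZ.
- exact: free_act1.
- exact: osc_act0.
- exact: osc_actM.
- by move=> x /asboolP; exact: osc_gen_ideal.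
- by rewrite free_act_gen osc_H_delta.
- by rewrite free_act_gen osc_Z_delta.
Qed.

(* The intersection of U(g)^k with the left ideal of U(g) generated by H - k and
   Z + 1/2; it is two-sided in U(g)^k. *)
Definition ideal_k : ideal2 UJk :=
  left_ideal_trace2
    (commutant_subl k) (commutant_addr 2^-1)
    left_ideal_k_proper.

Definition DJ : Type := alg_quot ideal_k.
HB.instance Definition _ := GRing.Algebra.on DJ.

Definition calE : DJ := alg_proj ideal_k (exist _ U_calE U_calE_commutant).
Definition calC : DJ := alg_proj ideal_k (exist _ U_calC U_calC_commutant).

End DJ.
End Jacobi.

Section Representations.
Variables (C : numClosedFieldType) (A : algType C).

Record representation := Representation {
  rep_space :> lmodType C;
  rep_op : A -> rep_space -> rep_space;
  rep_op_linear : forall x, linear (rep_op x);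
  rep_op_linear_l : forall v, linear (rep_op^~ v);
  rep_op1 : forall v, rep_op 1 v = v;
  rep_opM : forall x y v, rep_op (x * y) v = rep_op x (rep_op y v)
}.

Definition subrepresentation (V : representation) (W : set V) : Prop :=
  [/\ W 0, forall (a : C) u v, W u -> W v -> W (a *: u + v)
    & forall x v, W v -> W (rep_op x v)].

Definition irreducible (V : representation) : Prop :=
  (exists v : V, v != 0) /\
  forall W : set V, subrepresentation W ->
    (forall v, W v -> v = 0) \/ (forall v, W v).

Definition equivalent (V W : representation) : Prop :=
  exists f : {linear V -> W},
    bijective f /\ forall x v, f (rep_op x v) = rep_op x (f v).

Definition one_dimensional (V : lmodType C) : Prop :=
  exists2 v : V, v != 0 & forall w : V, exists a : C, w = a *: v.

Definition finite_dimensional (V : lmodType C) (W : set V) : Prop :=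
  exists n (b : 'I_n -> V), forall w, W w ->
    exists a : 'I_n -> C, w = \sum_(i < n) a i *: b i.

Definition eigenvectors (V : lmodType C) (T : V -> V) (mu : C) : set V :=
  [set v | T v = mu *: v].

Definition eigenvalue_of (V : lmodType C) (T : V -> V) (mu : C) : Prop :=
  exists2 v, v != 0 & eigenvectors T mu v.

(* C is algebraically closed, so the simple C[T]-submodules of V are the lines
   spanned by eigenvectors, and V is semisimple when it is their sum. *)
Definition acts_semisimply (V : lmodType C) (T : V -> V) : Prop :=
  forall v, exists n (u : 'I_n -> V) (mu : 'I_n -> C),
    (forall i, eigenvectors T (mu i) (u i)) /\ v = \sum_(i < n) u i.

Section Character.
Variable chi : {lrmorphism A -> C^o}.

Definition character_op (x : A) (v : C^o) : C^o := chi x * v.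

Lemma character_op_linear x : linear (character_op x).
Proof. by move=> a u v; rewrite /character_op mulrDr scalerAr. Qed.

Lemma character_op_linear_l v : linear (character_op^~ v).
Proof. by move=> a x y; rewrite /character_op linearP mulrDl scalerAl. Qed.

Lemma character_op1 v : character_op 1 v = v.
Proof. by rewrite /character_op rmorph1 mul1r. Qed.

Lemma character_opM x y v :
  character_op (x * y) v = character_op x (character_op y v).
Proof. by rewrite /character_op rmorphM mulrA. Qed.

Definition character_rep : representation :=
  Representation character_op_linear character_op_linear_l
                 character_op1 character_opM.
End Character.

End Representations.

Section Vk.
Variables (C : numClosedFieldType) (k : C).

Definition admissible (V : representation (DJ k)) : Prop :=
  acts_semisimply (rep_op (calE k) : V -> V) /\
  forall mu, finite_dimensional (eigenvectors (rep_op (calE k) : V -> V) mu).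

Definition central_character (c : C) (V : representation (DJ k)) : Prop :=
  forall v : V, rep_op (calC k) v = c *: v.

Definition weights (V : representation (DJ k)) : set C :=
  [set mu | eigenvalue_of (fun v : V => rep_op (calE k) v + k *: v) mu].

(* The coset lam + 2Z extended by its bottom and top is encoded by \bar int:
   n%:E stands for lam + 2n. *)
Definition Mminus (c lam : C) : set (\bar int) :=
  [set -oo%E] `|`
  [set n%:E%E | n in [set n : int | n <= 0 /\ lam + 2 * n%:~R \in
    [:: k + 1 / 2; k + 3 / 2; 1 + sqrtC (c + 1); 1 - sqrtC (c + 1)]]].

Definition Mplus (c lam : C) : set (\bar int) :=
  [set +oo%E] `|`
  [set n%:E%E | n in [set n : int | 0 <= n /\ lam + 2 * n%:~R \in
    [:: k - 1 / 2; k - 3 / 2; - 1 + sqrtC (c + 1); - 1 - sqrtC (c + 1)]]].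

Definition is_max (S : set (\bar int)) (a : \bar int) : Prop :=
  S a /\ ubound S a.
Definition is_min (S : set (\bar int)) (a : \bar int) : Prop :=
  S a /\ lbound S a.

Definition Delta (c lam : C) : set C :=
  [set lam + 2 * n%:~R | n in [set n : int | exists a b : \bar int,
    [/\ is_max (Mminus c lam) a, is_min (Mplus c lam) b,
        (a <= n%:E)%E & (n%:E <= b)%E]]].

(* V is (a model of) V_k(c, lam), which is unique up to equivalence *)
Definition is_Vk (c lam : C) (V : representation (DJ k)) : Prop :=
  [/\ irreducible V, admissible V, central_character c V
    & weights V = Delta c lam].

Definition one_dim_params : 5.-tuple (C * C) :=
  [tuple (0, 0);
         ((k + 3 / 2) ^+ 2 - 1, k + 1 / 2); ((k - 3 / 2) ^+ 2 - 1, k - 1 / 2);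
         ((k + 5 / 2) ^+ 2 - 1, k + 3 / 2); ((k - 5 / 2) ^+ 2 - 1, k - 3 / 2)].

Definition is_Vk_param (i : 'I_5) : representation (DJ k) -> Prop :=
  is_Vk (tnth one_dim_params i).1 (tnth one_dim_params i).2.

End Vk.

(* Main.v *)
Require Import Defs.
From HB Require Import structures.
From mathcomp Require Import all_boot all_order all_algebra.
From mathcomp Require Import boolp classical_sets functions.
From mathcomp Require Import constructive_ereal zify ring.
From mathcomp.multinomials Require Import -(notations) monalg.
From mathcomp Require Import reals complex.

Set Implicit Arguments.
Unset Strict Implicit.
Unset Printing Implicit Defensive.

Import Order.TTheory GRing.Theory Num.Theory.
Local Open Scope ring_scope.

(** In A = U(g)/(Z + 1/2) the elements e and f satisfy [e, f] = 1, and the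
    corrected elements E_nu, F_nu, H_nu form an sl2-triple commuting with them.
    So A is spanned by the products of a power of E_nu or F_nu, a power of f or
    e, and a polynomial in H_nu, w = f e and the Casimir element. Every such
    product is an eigenvector of ad H, and those of eigenvalue 0 are products of
    powers of X = E_nu f^2 or of Y = F_nu e^2 with such polynomials. As w becomes
    h - k - 1/2 modulo H - k, where h is the class of H_nu, the algebra D_k is
    generated by h, the Casimir element C, X and Y ([DJ_ind]), with
      h X = X (h + 2),    h Y = Y (h - 2),
      4 Y X = (C - h (h + 2)) (h - k + 1/2) (h - k + 3/2),
      4 X Y = (C - h (h - 2)) (h - k - 1/2) (h - k - 3/2).

    On a 1-dimensional representation h and C act by scalars mu and c. Since X
    and Y change the eigenvalue of h they act by 0, so the right-hand sides of
    the last two relations vanish at (c, mu): these are the conditions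
    [top_weight] and [bottom_weight]. Each has three factors; of the nine
    combinations four are contradictory and the other five give the five listed
    pairs ([roots_params]). A character is determined by its pair, and the
    weights mu of the last four pairs are distinct, so two of the five
    characters coincide exactly when one of those four weights is 0; the pair is
    then (0, 0).

    Conversely a pair (c, mu) with both conditions comes from a character
    ([exists_character]). For any c and mu, the tensor product of a weight
    module of sl2 and one of the Weyl algebra is a U(g)-module on which Z acts by
    -1/2; its part of H-weight k has a basis v_i indexed by the integers, on
    which h acts by mu + 2 i, X raises i by 1 and Y lowers it by 1. The two
    conditions say that Y kills v_1 and v_0, so the spans of the v_i with i >= 0
    and of those with i >= 1 are stable, and their quotient is the line wanted.

    For such a pair the two sets bounding the weights both have extremum mu, so
    the prescribed set of weights is {mu} ([Delta_point]). A representation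
    V_k(c, mu) then has h = mu by semisimplicity, hence X = Y = 0, hence D_k acts
    by scalars through the character, and irreducibility makes it
    1-dimensional. *)

(** * Algebras given by generators *)

Section FreeAlgebraInduction.
Variables (C : comNzRingType) (B : choiceType).

Lemma free_alg_ind (P : free_alg C B -> Prop) :
  P 1 -> (forall x y, P x -> P y -> P (x + y)) ->
  (forall a x, P x -> P (a *: x)) ->
  (forall b x, P x -> P (free_gen C b * x)) -> forall x, P x.
Proof.
move=> P1 PD PZ PM x.
have word (s : seq B) : P (mkmalgU (FMonom s) 1).
  elim: s => [|b s IHs].
    have <- : 1 = mkmalgU (FMonom (I := B) [::]) 1 :> free_alg C B; last by [].
    by rewrite [1]/(mkmalgU _ 1); congr mkmalgU; apply: val_inj; rewrite /= fm1.
  have -> : mkmalgU (FMonom (b :: s)) 1 =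
      free_gen C b * mkmalgU (FMonom s) 1 :> free_alg C B.
    rewrite /free_gen [RHS]malgM_def fgmulUU mulr1; congr mkmalgU.
    by apply: val_inj; rewrite /= fmM fmU.
  exact: PM.
rewrite [x]monalgE; elim/big_rec: _ => [|m y _ Py].
  by rewrite -(scale0r (1 : free_alg C B)); exact: PZ.
apply: PD => //; have -> : mkmalgU m (mcoeff m x) =
    mcoeff m x *: mkmalgU (FMonom m) 1 :> free_alg C B; last exact: PZ.
by apply/malgP => m'; rewrite mcoeffZ !mcoeffU mulr_natr; case: m.
Qed.
End FreeAlgebraInduction.

Section GeneratedSubalgebra.
Variables (C : comNzRingType) (A : algType C).

Inductive gen_subalg (S : A -> Prop) : A -> Prop :=
| gen_subalg_base x of S x : gen_subalg S x
| gen_subalg_const a : gen_subalg S (a *: 1)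
| gen_subalgD x y of gen_subalg S x & gen_subalg S y : gen_subalg S (x + y)
| gen_subalgM x y of gen_subalg S x & gen_subalg S y : gen_subalg S (x * y).

Variable S : A -> Prop.

Lemma gen_subalg1 : gen_subalg S 1.
Proof. by rewrite -[1]scale1r; exact: gen_subalg_const. Qed.

Lemma gen_subalg0 : gen_subalg S 0.
Proof. by rewrite -(scale0r 1); exact: gen_subalg_const. Qed.

Lemma gen_subalgZ a x : gen_subalg S x -> gen_subalg S (a *: x).
Proof.
by move=> Sx; rewrite -mulr_algl; apply: gen_subalgM => //; exact: gen_subalg_const.
Qed.

Lemma gen_subalgB x y : gen_subalg S x -> gen_subalg S y -> gen_subalg S (x - y).
Proof.
by move=> Sx Sy; rewrite -scaleN1r; apply: gen_subalgD => //; exact: gen_subalgZ.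
Qed.

Lemma gen_subalgX x n : gen_subalg S x -> gen_subalg S (x ^+ n).
Proof.
by move=> Sx; elim: n => [|n IHn]; [exact: gen_subalg1|rewrite exprS; exact: gen_subalgM].
Qed.

Lemma gen_subalg_sub (S' : A -> Prop) x :
  (forall y, S y -> gen_subalg S' y) -> gen_subalg S x -> gen_subalg S' x.
Proof.
move=> SS'; elim=> {x} [x /SS'//|a|x y _ Sx _ Sy|x y _ Sx _ Sy].
- exact: gen_subalg_const.
- exact: gen_subalgD.
- exact: gen_subalgM.
Qed.

Lemma gen_subalg_comm g x :
  (forall y, S y -> GRing.comm g y) -> gen_subalg S x -> GRing.comm g x.
Proof.
move=> gS; elim=> {x} [x /gS//|a|x y _ gx _ gy|x y _ gx _ gy].
- by rewrite /GRing.comm -scalerAl -scalerAr mulr1 mul1r.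
- exact: commrD.
- exact: commrM.
Qed.

(** When [ad x] acts on [g] by a scalar, [x * g = g * (x + scalar)]: coefficients
    cross [g] at the cost of being changed. *)
Definition skew (g : A) : Prop :=
  forall x, gen_subalg S x -> exists2 x', gen_subalg S x' & x * g = g * x'.

Lemma skew_gen g :
  (forall x, S x -> exists2 x', gen_subalg S x' & x * g = g * x') -> skew g.
Proof.
move=> gS x; elim=> {x} [x /gS//|a|x y _ [x' Sx xE] _ [y' Sy yE]|].
- exists (a *: 1); first exact: gen_subalg_const.
  by rewrite -scalerAl -scalerAr mulr1 mul1r.
- by exists (x' + y'); [exact: gen_subalgD|rewrite mulrDl mulrDr xE yE].
move=> x y _ [x' Sx xE] _ [y' Sy yE]; exists (x' * y'); first exact: gen_subalgM.
by rewrite -mulrA yE mulrA xE -mulrA.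
Qed.

Lemma skewX g n : skew g -> skew (g ^+ n).
Proof.
move=> gS; elim: n => [|n IHn] x Sx; first by exists x; rewrite // mulr1 mul1r.
have [y Sy xE] := gS x Sx; have [z Sz yE] := IHn y Sy; exists z => //.
by rewrite exprS mulrA xE -mulrA yE mulrA.
Qed.

(** [y] stands in for an inverse of [x]: for [E] and [F], or for [f] and [e], the
    product of the two is a coefficient instead of 1. *)
Definition zpow (x y : A) (m : int) : A :=
  match m with Posz n => x ^+ n | Negz n => y ^+ n.+1 end.

Lemma zpowN x y m : zpow x y (- m) = zpow y x m.
Proof. by case: m => [[|n]|n]; rewrite ?oppr0 ?NegzE ?opprK. Qed.

Lemma skew_zpow x y m : skew x -> skew y -> skew (zpow x y m).
Proof. by move=> xS yS; case: m => n; exact: skewX. Qed.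

(** For [m < 0] one factor [x * y] appears on the left; it is a coefficient, and
    skew commutation carries it to the far right. *)
Lemma zpow_shift x y m : gen_subalg S (x * y) -> skew y ->
  exists2 r, gen_subalg S r & x * zpow x y m = zpow x y (m + 1) * r.
Proof.
move=> Sxy yS; case: m => n.
  by exists 1; [exact: gen_subalg1|rewrite mulr1 -exprS -PoszD addn1].
have -> : zpow x y (Negz n + 1) = y ^+ n.
  by case: n => [|n]; rewrite NegzE ?addNr // -addn1 PoszD opprD addrNK -NegzE.
elim: n => [|n [r Sr rE]] /=; first by exists (x * y); rewrite ?mul1r.
have [r' Sr' r'E] := yS r Sr; exists r' => //.
by rewrite exprSr mulrA [x * _]rE -mulrA r'E mulrA -exprSr.
Qed.

Lemma zpow_shiftN x y m : gen_subalg S (y * x) -> skew x ->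
  exists2 r, gen_subalg S r & y * zpow x y m = zpow x y (m - 1) * r.
Proof.
move=> Sxy xS; have [r Sr rE] := zpow_shift (- m) Sxy xS; exists r => //.
by rewrite -zpowN rE -zpowN opprD opprK.
Qed.

End GeneratedSubalgebra.

(** * The commutant in the product of U(sl2) and the Weyl algebra *)

Section Separation.
Variables (C : fieldType) (A : algType C) (H : A).

(** Eigenspaces of [ad H] for different eigenvalues are independent. The
    coefficients [a] give the induction room: applying [ad H - n], where [n] is
    the first eigenvalue, removes one term and rescales the others. *)
Lemma ad_weight_separation (s : seq (C * A)) (a : C * A -> C) (d : A) :
  ad_weight H 1 0 d -> d = \sum_(p <- s) a p *: p.2 ->
  (forall p, p \in s -> p.1 != 0 /\ ad_weight H 1 p.1 p.2) -> d = 0.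
Proof.
elim: s a d => [|[n x] s IHs] a d dH dE sH; first by rewrite dE big_nil.
have [n0 _] := sH _ (mem_head _ _).
have sE : H * d - d * H = \sum_(p <- (n, x) :: s) p.1 *: (a p *: p.2).
  rewrite dE mulr_sumr mulr_suml -sumrB; apply: eq_big_seq => p /sH[_ pH].
  by case: (ad_weightZ (a p) pH).
move: (dH) => [/eqP]; rewrite scale0r sE big_cons /= addr_eq0 => /eqP nx _.
suff /eqP : - n *: d = 0 by rewrite scaler_eq0 oppr_eq0 (negPf n0) => /eqP.
apply: (IHs (fun p => (p.1 - n) * a p)); first exact: ad_weightZ.
  rewrite dE big_cons /= scalerDr scaleNr nx opprK scaler_sumr -big_split /=.
  by apply: eq_bigr => p _; rewrite -scalerA scalerBl scaleNr.
by move=> p ps; apply: sH; rewrite inE ps orbT.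
Qed.
End Separation.

Section Sl2Weyl.
Variables (C : numFieldType) (A : algType C) (E F e f h w : A).
Let H := h - w - 2^-1 *: 1.
Let X := E * f ^+ 2.
Let Y := F * e ^+ 2.
Let casimir := h ^+ 2 + 2 *: h + 4 *: (F * E).

Hypothesis hE : h * E = E * (h + 2%:R).
Hypothesis hF : h * F = F * (h - 2%:R).
Hypothesis EF : E * F = h + F * E.
Hypotheses (fe : f * e = w) (ef : e * f = w + 1).
Hypotheses (Ee : GRing.comm E e) (Ef : GRing.comm E f).
Hypotheses (Fe : GRing.comm F e) (Ff : GRing.comm F f).

Let we : w * e = e * (w - 1).
Proof. by rewrite mulrBr mulr1 -{2}fe mulrA ef mulrDl mul1r addrK. Qed.

Let wf : w * f = f * (w + 1).
Proof. by rewrite -ef mulrA fe. Qed.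

Lemma sl2_h_comm (g : A) : GRing.comm g E -> GRing.comm g F -> GRing.comm g h.
Proof.
move=> gE gF; have -> : h = E * F - F * E by rewrite EF addrK.
by apply: commrB; apply: commrM.
Qed.

Let comm_wE : GRing.comm E w. Proof. by rewrite -fe; exact: commrM. Qed.
Let comm_wF : GRing.comm F w. Proof. by rewrite -fe; exact: commrM. Qed.
Let comm_he : GRing.comm e h.
Proof. by apply: sl2_h_comm; apply: commr_sym. Qed.
Let comm_hf : GRing.comm f h.
Proof. by apply: sl2_h_comm; apply: commr_sym. Qed.
Let comm_hw : GRing.comm h w.
Proof. by rewrite -fe; apply: commrM; apply: commr_sym. Qed.

Let comm_scale (g : A) a x : GRing.comm g x -> GRing.comm g (a *: x).
Proof. by move=> gx; rewrite /GRing.comm -scalerAl -scalerAr gx. Qed.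

Lemma sl2_casimirFE : casimir = h * (h + 2%:R) + 4 *: (F * E).
Proof. by rewrite /casimir mulrDr mulr_natr scaler_nat expr2. Qed.

Lemma sl2_casimirEF : casimir = h * (h - 2%:R) + 4 *: (E * F).
Proof.
have aux (a : A) : a * (a + 2%:R) = a * (a - 2%:R) + 4 *: a.
  by rewrite mulrDr mulrBr mulr_natr scaler_nat addrAC -addrA -mulrnBr.
by rewrite sl2_casimirFE EF (scalerDr 4) (addrA (h * _)) -aux.
Qed.

Lemma sl2_casimir_comm (g : A) :
  GRing.comm g E -> GRing.comm g F -> GRing.comm g casimir.
Proof.
move=> gE gF; have gh := sl2_h_comm gE gF.
apply: commrD; last exact/comm_scale/commrM.
by apply: commrD; [apply: commrX|apply: comm_scale].
Qed.

(** Each of the two expressions of the Casimir element is used on one side. *)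
Lemma sl2_casimir_commE : GRing.comm E casimir.
Proof.
have hE2 : (h - 2%:R) * E = E * h.
  by rewrite mulrBl hE mulrDr -commr_nat addrK.
rewrite /GRing.comm {1}sl2_casimirFE sl2_casimirEF.
rewrite (mulrDr E) (mulrDl _ _ E) -(scalerAl 4) -(scalerAr 4) !mulrA; congr (_ + _).
rewrite -[RHS]mulrA hE2 mulrA hE -!mulrA; congr (_ * _).
by rewrite mulrDl mulrDr commr_nat.
Qed.

Lemma sl2_casimir_commF : GRing.comm F casimir.
Proof.
have hF2 : (h + 2%:R) * F = F * h.
  by rewrite mulrDl hF mulrBr -commr_nat subrK.
rewrite /GRing.comm {1}sl2_casimirEF sl2_casimirFE.
rewrite (mulrDr F) (mulrDl _ _ F) -(scalerAl 4) -(scalerAr 4) !mulrA; congr (_ + _).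
rewrite -[RHS]mulrA hF2 mulrA hF -!mulrA; congr (_ * _).
by rewrite mulrBl mulrBr commr_nat.
Qed.

Lemma sl2_casimir_commh : GRing.comm h casimir.
Proof.
apply/commr_sym/sl2_h_comm; apply/commr_sym.
  exact: sl2_casimir_commE.
exact: sl2_casimir_commF.
Qed.

(** Moving [E] past [e ^+ 2] separates [Y * X] into [F * E], which the Casimir
    element and [h] determine, and [e ^+ 2 * f ^+ 2], which [w] determines. *)
Lemma sl2_weyl_YX :
  4 *: (Y * X) = (casimir - h * (h + 2%:R)) * ((w + 1) * (w + 2%:R)).
Proof.
have -> : casimir - h * (h + 2%:R) = 4 *: (F * E).
  by rewrite sl2_casimirFE addrAC subrr add0r.
rewrite -scalerAl; congr (_ *: _); rewrite /X /Y.
have -> : (w + 1) * (w + 2%:R) = e ^+ 2 * f ^+ 2.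
  have fw : (w + 1) * f = f * (w + 2%:R).
    by rewrite mulrDl wf mul1r -[2%:R]/(1 + 1) addrA [in RHS]mulrDr mulr1.
  by rewrite !expr2 -mulrA (mulrA e f f) ef fw mulrA ef.
by rewrite mulrA -(mulrA F) -(commrX 2 Ee) !mulrA.
Qed.

Lemma sl2_weyl_XY :
  4 *: (X * Y) = (casimir - h * (h - 2%:R)) * (w * (w - 1)).
Proof.
have -> : casimir - h * (h - 2%:R) = 4 *: (E * F).
  by rewrite sl2_casimirEF addrAC subrr add0r.
rewrite -scalerAl; congr (_ *: _); rewrite /X /Y.
have -> : w * (w - 1) = f ^+ 2 * e ^+ 2.
  by rewrite !expr2 !mulrA -(mulrA f f e) fe -(mulrA f w e) we mulrA fe.
by rewrite mulrA -(mulrA E) -(commrX 2 Ff) !mulrA.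
Qed.

Lemma sl2_weyl_hX : h * X = X * (h + 2%:R).
Proof.
have fh : GRing.comm (f ^+ 2) (h + 2%:R).
  apply: commrD; last exact: commr_nat.
  exact/commr_sym/commrX/commr_sym.
by rewrite /X mulrA hE -mulrA -fh mulrA.
Qed.

Lemma sl2_weyl_hY : h * Y = Y * (h - 2%:R).
Proof.
have eh : GRing.comm (e ^+ 2) (h - 2%:R).
  apply: commrB; last exact: commr_nat.
  exact/commr_sym/commrX/commr_sym.
by rewrite /Y mulrA hF -mulrA -eh mulrA.
Qed.

(** The generators of the coefficients [q] in [zpow E F m * zpow f e i * q]. *)
Let coefs (x : A) := [\/ x = h, x = w | x = casimir].
Let Q := gen_subalg coefs.

Let Qh : Q h. Proof. by apply: gen_subalg_base; constructor 1. Qed.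
Let Qw : Q w. Proof. by apply: gen_subalg_base; constructor 2. Qed.
Let Qc : Q casimir. Proof. by apply: gen_subalg_base; constructor 3. Qed.
Let Qn n : Q n%:R.
Proof. by rewrite -scaler_nat; exact: gen_subalg_const. Qed.

Let skew_comm (g : A) x : GRing.comm g x -> Q x ->
  exists2 x', Q x' & x * g = g * x'.
Proof. by exists x. Qed.

Let skewE : skew coefs E.
Proof.
apply: skew_gen => x [] ->.
- by exists (h + 2%:R); [exact: (gen_subalgD Qh (Qn 2))|].
- exact: skew_comm.
- by apply: skew_comm => //; exact: sl2_casimir_commE.
Qed.

Let skewF : skew coefs F.
Proof.
apply: skew_gen => x [] ->.
- by exists (h - 2%:R); [exact: (gen_subalgB Qh (Qn 2))|].
- exact: skew_comm.
- by apply: skew_comm => //; exact: sl2_casimir_commF.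
Qed.

Let skewe : skew coefs e.
Proof.
apply: skew_gen => x [] ->.
- exact: skew_comm.
- by exists (w - 1); [apply: gen_subalgB => //; exact: gen_subalg1|].
- by apply: skew_comm => //; apply: sl2_casimir_comm; exact: commr_sym.
Qed.

Let skewf : skew coefs f.
Proof.
apply: skew_gen => x [] ->.
- exact: skew_comm.
- by exists (w + 1); [apply: gen_subalgD => //; exact: gen_subalg1|].
- by apply: skew_comm => //; apply: sl2_casimir_comm; exact: commr_sym.
Qed.

Let QFE : Q (F * E).
Proof.
have -> : F * E = 4^-1 *: (casimir - h * (h + 2%:R)).
  rewrite sl2_casimirFE addrAC subrr add0r scalerA mulVf ?scale1r //.
  by rewrite pnatr_eq0.
apply/gen_subalgZ/gen_subalgB => //.
exact: (gen_subalgM Qh (gen_subalgD Qh (Qn 2))).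
Qed.

Inductive spanned : A -> Prop :=
| spanned0 : spanned 0
| spannedD m i q x of Q q & spanned x :
    spanned (zpow E F m * zpow f e i * q + x).

Lemma spanned_add x y : spanned x -> spanned y -> spanned (x + y).
Proof.
move=> Sx Sy; elim: Sx => [|m i q {}x Qq _ IHx]; first by rewrite add0r.
by rewrite -addrA; exact: spannedD.
Qed.

Lemma spannedMl g x :
  (forall m i, exists m' i', exists2 r, Q r &
     g * (zpow E F m * zpow f e i) = zpow E F m' * zpow f e i' * r) ->
  spanned x -> spanned (g * x).
Proof.
move=> gS; elim=> [|m i q {}x Qq _ IHx]; first by rewrite mulr0; exact: spanned0.
have [m' [i' [r Qr rE]]] := gS m i.
by rewrite mulrDr mulrA rE -mulrA; apply: spannedD => //; exact: gen_subalgM.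
Qed.

Let comm_zpow (g x y : A) m :
  GRing.comm g x -> GRing.comm g y -> GRing.comm g (zpow x y m).
Proof. by move=> gx gy; case: m => n; exact: commrX. Qed.

Lemma spanned_scale a x : spanned x -> spanned (a *: x).
Proof.
elim=> [|m i q {}x Qq _ IHx]; first by rewrite scaler0; exact: spanned0.
by rewrite scalerDr scalerAr; apply: spannedD => //; exact: gen_subalgZ.
Qed.

Lemma spanned_sl2 (g : A) (s : int) :
  (forall m, exists2 r, Q r & g * zpow E F m = zpow E F (m + s) * r) ->
  forall x, spanned x -> spanned (g * x).
Proof.
move=> gS x; apply: spannedMl => m i; exists (m + s), i.
have [r Qr rE] := gS m.
have [r' Qr' r'E] := skew_zpow i skewf skewe Qr.
by exists r' => //; rewrite mulrA rE -mulrA r'E mulrA.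
Qed.

Lemma spanned_weyl (g : A) (s : int) :
  (forall m, exists2 r, Q r & g * zpow f e m = zpow f e (m + s) * r) ->
  GRing.comm g E -> GRing.comm g F ->
  forall x, spanned x -> spanned (g * x).
Proof.
move=> gS gE gF x; apply: spannedMl => m i; exists m, (i + s).
have [r Qr rE] := gS i; exists r => //.
by rewrite mulrA (comm_zpow m gE gF : _ = _) -(mulrA _ g) rE mulrA.
Qed.

(** A Poincare-Birkhoff-Witt argument: the span contains 1 and is stable under
    left multiplication by each generator, which shifts one of the two exponents
    and contributes a coefficient. *)
Lemma spanned_all :
  (forall P : A -> Prop, P 1 -> (forall x y, P x -> P y -> P (x + y)) ->
     (forall a x, P x -> P (a *: x)) ->
     (forall x, P x -> [/\ P (E * x), P (F * x), P (e * x) & P (f * x)]) ->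
     forall x, P x) ->
  forall x, spanned x.
Proof.
have QEF : Q (E * F) by rewrite EF; exact: gen_subalgD.
have Qfe : Q (f * e) by rewrite fe.
have Qef : Q (e * f) by rewrite ef; apply: gen_subalgD => //; exact: gen_subalg1.
apply.
- have := spannedD 0 0 (gen_subalg1 _) spanned0.
  by rewrite /= !expr0 !mulr1 addr0.
- exact: spanned_add.
- exact: spanned_scale.
move=> x Sx; split.
- by apply: (spanned_sl2 (s := 1)) => // m; exact: zpow_shift.
- by apply: (spanned_sl2 (s := -1)) => // m; exact: zpow_shiftN.
- apply: (spanned_weyl (s := -1)); rewrite //; try exact: commr_sym.
  by move=> m; exact: zpow_shiftN.
- apply: (spanned_weyl (s := 1)); rewrite //; try exact: commr_sym.
  by move=> m; exact: zpow_shift.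
Qed.

Let adH := ad_weight H 1.

Let adH_comm (x : A) : GRing.comm H x -> adH 0 x.
Proof. by move=> Hx; split; rewrite ?mulr1 ?mul1r // Hx subrr scale0r. Qed.

Let adH_of (n : C) (x : A) : H * x - x * H = n *: x -> adH n x.
Proof. by split; rewrite ?mulr1 ?mul1r. Qed.

Let lieH (x : A) : H * x - x * H = (h * x - x * h) - (w * x - x * w).
Proof.
rewrite /H !mulrBl !mulrBr -scalerAl -scalerAr mulr1 mul1r.
set c := _ *: x; rewrite !opprB !addrA addrNK.
rewrite -!addrA; congr (_ + _); rewrite !addrA addrC -!addrA; congr (_ + _).
by rewrite addrC.
Qed.

Let adH_E : adH 2 E.
Proof.
apply: adH_of; rewrite lieH hE (comm_wE : _ = _) subrr subr0 mulrDr addrAC subrr add0r.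
by rewrite mulr_natr scaler_nat.
Qed.

Let adH_F : adH (- 2) F.
Proof.
apply: adH_of; rewrite lieH hF (comm_wF : _ = _) subrr subr0 mulrBr addrAC subrr add0r.
by rewrite mulr_natr scaleNr scaler_nat.
Qed.

Let adH_e : adH 1 e.
Proof.
apply: adH_of; rewrite lieH we (comm_he : _ = _) subrr sub0r mulrBr mulr1 scale1r.
by rewrite addrAC subrr add0r opprK.
Qed.

Let adH_f : adH (- 1) f.
Proof.
apply: adH_of; rewrite lieH wf (comm_hf : _ = _) subrr sub0r mulrDr mulr1 scaleN1r.
by rewrite addrAC subrr add0r.
Qed.

Let adH_X n a x : adH a x -> adH (n%:R * a) (x ^+ n).
Proof.
move=> xa; elim: n => [|n IHn].
  by rewrite mul0r expr0; exact: ad_weight1.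
by rewrite exprS mulrS mulrDl mul1r; exact: ad_weightM.
Qed.

Let adH_zpow m a x y : adH a x -> adH (- a) y -> adH (m%:~R * a) (zpow x y m).
Proof.
move=> xa ya; case: m => n; first exact: adH_X.
by rewrite NegzE mulrNz mulNr -mulrN; exact: adH_X.
Qed.

Let adH_Q q : Q q -> adH 0 q.
Proof.
move=> Qq; apply/adH_comm/commr_sym/commrB; last first.
  exact/comm_scale/commr1.
have hQ : GRing.comm h q.
  apply: (gen_subalg_comm (S := coefs)) Qq => x [] -> //.
  exact: sl2_casimir_commh.
have wQ : GRing.comm w q.
  apply: (gen_subalg_comm (S := coefs)) Qq => x [] ->.
  - exact/commr_sym.
  - by [].
  - by apply: sl2_casimir_comm; apply/commr_sym.
by apply: commrB; exact: commr_sym.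
Qed.

Let adH_mono m i q : Q q ->
  adH ((m *+ 2 - i)%:~R) (zpow E F m * zpow f e i * q).
Proof.
move=> Qq; rewrite -[_%:~R]addr0; apply: ad_weightM; last exact: adH_Q.
have -> : (m *+ 2 - i)%:~R = m%:~R * 2 + i%:~R * (- 1) :> C.
  by rewrite rmorphB rmorphMn /= mulr_natr mulrN1.
by apply: ad_weightM; apply: adH_zpow; rewrite ?opprK.
Qed.

Let gens (x : A) := [\/ coefs x, x = X | x = Y].

Let zpow_weight0 m : gen_subalg gens (zpow E F m * zpow f e (m *+ 2)).
Proof.
case: m => n.
  have -> : Posz n *+ 2 = Posz (2 * n) by rewrite -mulr_natl.
  rewrite /= exprM -exprMn_comm; last exact: commrX.
  by apply: gen_subalgX; apply: gen_subalg_base; constructor 2.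
have -> : Negz n *+ 2 = Negz (2 * n).+1.
  by rewrite !NegzE mulNrn -mulr_natl -PoszM mulnS.
rewrite /= -[(2 * n).+2]/(2 + 2 * n)%N -mulnS exprM -exprMn_comm; last exact: commrX.
by apply: gen_subalgX; apply: gen_subalg_base; constructor 3.
Qed.

Let adH_gens y : gens y -> adH 0 y.
Proof.
have -> : 0 = 2 + 2%:R * (- 1) :> C by rewrite mulrN1 subrr.
case=> [Cy| -> | ->].
- by rewrite mulrN1 subrr; apply: adH_Q; exact: gen_subalg_base.
- by apply: ad_weightM => //; exact: adH_X.
- rewrite mulrN1 addrC -{2}[2](mulr1 2%:R).
  by apply: ad_weightM => //; exact: adH_X.
Qed.

(** A vector commuting with [H] has weight 0, and the monomials of weight 0 are
    those with [i = 2 m], which are the powers of [X] and [Y]. *)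
Lemma commutant_gen :
  (forall x, spanned x) ->
  forall x, GRing.comm H x -> gen_subalg gens x.
Proof.
move=> /[swap] x /[swap] Hx /(_ x) Sx.
suff [b [s [Bb xE sH]]] : exists b (s : seq (C * A)), [/\ gen_subalg gens b,
    x = b + \sum_(p <- s) p.2 & forall p, p \in s -> p.1 != 0 /\ adH p.1 p.2].
  have Hb : adH 0 (x - b).
    rewrite -scaleN1r; apply: ad_weightD; first exact: adH_comm.
    apply/ad_weightZ/adH_comm/(gen_subalg_comm _ Bb) => y.
    by move=> /adH_gens[] /eqP; rewrite scale0r subr_eq0 => /eqP.
  suff : x - b = 0 by move=> /subr0_eq ->.
  apply: (ad_weight_separation (s := s) (a := fun=> 1) Hb) => //.
  by rewrite xE addrAC subrr add0r; apply: eq_bigr => p _; rewrite scale1r.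
elim: {x Hx} Sx => [|m i q x Qq _ [b [s [Bb -> sH]]]].
  by exists 0, [::]; split=> //; [exact: gen_subalg0|rewrite big_nil addr0].
have [iE|iE] := eqVneq i (m *+ 2).
  exists (zpow E F m * zpow f e i * q + b), s; split; rewrite ?addrA //.
  apply: gen_subalgD => //; apply: gen_subalgM; first by rewrite iE.
  by apply: gen_subalg_sub Qq => y Cy; apply: gen_subalg_base; constructor 1.
exists b, (((m *+ 2 - i)%:~R, zpow E F m * zpow f e i * q) :: s); split=> //.
  by rewrite big_cons /= addrCA.
move=> p; rewrite inE => /orP[/eqP -> /=|/sH//].
split; last exact: adH_mono.
by rewrite intr_eq0 subr_eq0 eq_sym.
Qed.
End Sl2Weyl.

(** * The sl2-triple corrected by the oscillator *)

Section Commutator.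
Variables (C : comNzRingType) (A : algType C).
Implicit Types x y z : A.

Definition lie x y := x * y - y * x.

Lemma lieDr x y z : lie x (y + z) = lie x y + lie x z.
Proof. by rewrite /lie mulrDr mulrDl opprD addrACA. Qed.

Lemma lieDl x y z : lie (y + z) x = lie y x + lie z x.
Proof. by rewrite /lie mulrDr mulrDl opprD addrACA. Qed.

Lemma lieZr a x y : lie x (a *: y) = a *: lie x y.
Proof. by rewrite /lie -scalerAl -scalerAr scalerBr. Qed.

Lemma lieZl a x y : lie (a *: x) y = a *: lie x y.
Proof. by rewrite /lie -scalerAl -scalerAr scalerBr. Qed.

Lemma lieC x y : lie y x = - lie x y.
Proof. by rewrite /lie opprB. Qed.

Lemma lieMr x y z : lie x (y * z) = lie x y * z + y * lie x z.
Proof. by rewrite /lie mulrBl mulrBr !mulrA addrA subrK. Qed.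

Lemma lieMl x y z : lie (y * z) x = lie y x * z + y * lie z x.
Proof. by rewrite [LHS]lieC lieMr [lie y x]lieC [lie z x]lieC mulNr mulrN -opprD. Qed.

Lemma lie1r x : lie x 1 = 0.
Proof. by rewrite /lie mulr1 mul1r subrr. Qed.

Lemma lie1l x : lie 1 x = 0.
Proof. by rewrite lieC lie1r oppr0. Qed.

Lemma liexx x : lie x x = 0.
Proof. exact: subrr. Qed.

Lemma lie_eq0 x y : lie x y = 0 <-> GRing.comm x y.
Proof. by split=> [/subr0_eq//|xy]; rewrite /lie xy subrr. Qed.

End Commutator.

(* The quadratic expressions in [e] and [f] form an sl2-triple acting on [e] and
   [f] as [E0], [F0], [H0] do; subtracting it leaves a triple that commutes with
   [e] and [f]. *)
Section OscillatorCorrection.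
Variables (C : numFieldType) (A : algType C) (E0 F0 H0 e f : A).
Let E := E0 + 2^-1 *: e ^+ 2.
Let F := F0 - 2^-1 *: f ^+ 2.
Let h := H0 + f * e + 2^-1 *: 1.

Hypotheses (H0E0 : lie H0 E0 = 2 *: E0) (H0F0 : lie H0 F0 = - (2 *: F0)).
Hypotheses (E0F0 : lie E0 F0 = H0) (H0e : lie H0 e = e) (H0f : lie H0 f = - f).
Hypotheses (E0e : lie E0 e = 0) (E0f : lie E0 f = - e).
Hypotheses (F0e : lie F0 e = - f) (F0f : lie F0 f = 0) (lie_ef : lie e f = 1).

Let lie_fe : lie f e = - 1. Proof. by rewrite lieC lie_ef. Qed.

Let half_dbl (x : A) : 2^-1 *: (x + x) = x.
Proof. by rewrite -mulr2n -scaler_nat scalerA mulVf ?scale1r // pnatr_eq0. Qed.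

Let EE : E = E0 + 2^-1 *: (e * e). Proof. by rewrite -expr2. Qed.
Let FE : F = F0 + - 2^-1 *: (f * f). Proof. by rewrite -expr2 scaleNr. Qed.

Lemma osc_comm_Ee : GRing.comm E e.
Proof.
by apply/lie_eq0; rewrite EE lieDl lieZl lieMl liexx E0e mul0r mulr0 addr0 scaler0 addr0.
Qed.

Lemma osc_comm_Ef : GRing.comm E f.
Proof.
by apply/lie_eq0; rewrite EE lieDl lieZl lieMl lie_ef E0f mul1r mulr1 half_dbl addNr.
Qed.

Lemma osc_comm_Fe : GRing.comm F e.
Proof.
apply/lie_eq0; rewrite FE lieDl lieZl lieMl lie_fe F0e mulN1r mulrN1 -opprD.
by rewrite scaleNr scalerN opprK half_dbl addNr.
Qed.

Lemma osc_comm_Ff : GRing.comm F f.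
Proof.
by apply/lie_eq0; rewrite FE lieDl lieZl lieMl liexx F0f mul0r mulr0 addr0 scaler0 addr0.
Qed.

Lemma osc_lie_EF : E * F = h + F * E.
Proof.
apply/eqP; rewrite -subr_eq -/(lie E F); apply/eqP.
have /lie_eq0 Ef := osc_comm_Ef.
rewrite {1}FE lieDr lieZr lieMr Ef mulr0 mul0r addr0 scaler0 addr0.
rewrite EE lieDl E0F0 lieZl lieMl [lie e F0]lieC F0e opprK.
have -> : e * f = f * e + 1 by rewrite -lie_ef /lie addrC subrK.
by rewrite /h -addrA; congr (_ + _); rewrite addrA scalerDr half_dbl.
Qed.

(* [f * e] and the constant commute with [E] and [F], so [h] acts on them as [H0]. *)
Let lie_h x : GRing.comm x e -> GRing.comm x f -> lie h x = lie H0 x.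
Proof.
move=> /lie_eq0 xe /lie_eq0 xf; rewrite /h !lieDl lieZl lie1l lieMl.
by rewrite [lie e x]lieC [lie f x]lieC xe xf !oppr0 mulr0 mul0r scaler0 !addr0.
Qed.

Lemma osc_hE : h * E = E * (h + 2%:R).
Proof.
apply/eqP; rewrite (mulrDr E h) (addrC (E * h)) -subr_eq -/(lie h E).
rewrite (lie_h osc_comm_Ee osc_comm_Ef) EE lieDr lieZr lieMr H0E0 H0e.
by rewrite mulr_natr mulrnDl scaler_nat -mulr2n scalerMnr.
Qed.

Lemma osc_hF : h * F = F * (h - 2%:R).
Proof.
apply/eqP; rewrite (mulrBr F h) (addrC (F * h)) -subr_eq -/(lie h F).
rewrite (lie_h osc_comm_Fe osc_comm_Ff) FE lieDr lieZr lieMr H0F0 H0f.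
rewrite mulr_natr mulrnDl scaler_nat.
by rewrite mulrN mulNr -opprD -mulr2n scalerN scalerMnr -opprD.
Qed.

End OscillatorCorrection.

(** * Generators and relations of D_k *)

Section Reduction.
Variable C : numClosedFieldType.
Local Notation U := (UJ C).
Local Notation UH := (Ugen C jH).
Local Notation UE := (Ugen C jE).
Local Notation UF := (Ugen C jF).
Local Notation Ue := (Ugen C je).
Local Notation Uf := (Ugen C jf).
Local Notation UZ := (Ugen C jZ).

Lemma UJ_ind (P : U -> Prop) :
  P 1 -> (forall x y, P x -> P y -> P (x + y)) ->
  (forall a x, P x -> P (a *: x)) ->
  (forall b x, P x -> P (Ugen C b * x)) -> forall x, P x.
Proof.
move=> P1 PD PZ PM x; have [t <-] := alg_proj_surj x.
elim/free_alg_ind: t => [|t u Pt Pu|a t Pt|b t Pt].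
- by rewrite alg_proj1.
- by rewrite alg_projD; exact: PD.
- by rewrite alg_projZ; exact: PZ.
- by rewrite alg_projM; exact: PM.
Qed.

Lemma UZ_central (x : U) : UZ * x = x * UZ.
Proof.
elim/UJ_ind: x => [|x y Zx Zy|a x Zx|b x Zx].
- by rewrite mulr1 mul1r.
- by rewrite mulrDr mulrDl Zx Zy.
- by rewrite -scalerAr -scalerAl Zx.
- by rewrite mulrA UJ_Z -!mulrA Zx.
Qed.

(** As Z + 1/2 is central, its left multiples already form a two-sided ideal. *)
Lemma gen_ideal_Z (x : U) :
  gen_ideal (fun z => z = UZ + 2^-1 *: 1) x -> exists b, x = b * (UZ + 2^-1 *: 1).
Proof.
elim=> {x} [x ->||x y _ [b ->] _ [c ->]|a x _ [b ->]|a x _ [b ->]].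
- by exists 1; rewrite mul1r.
- by exists 0; rewrite mul0r.
- by exists (b + c); rewrite mulrDl.
- by exists (a * b); rewrite mulrA.
- exists (b * a); rewrite -!mulrA; congr (_ * _).
  by rewrite mulrDl mulrDr UZ_central -scalerAl -scalerAr mulr1 mul1r.
Qed.

(** Otherwise the left ideal defining D_0 would contain 1. *)
Lemma gen_ideal_Z_proper : ~ gen_ideal (fun z => z = UZ + 2^-1 *: 1) (1 : U).
Proof.
move=> /gen_ideal_Z[b bE]; apply: (@left_ideal_k_proper C 0).
by exists 0, b; rewrite mul0r add0r.
Qed.

Definition AJ : Type := alg_quot (ideal_gen_by gen_ideal_Z_proper).
HB.instance Definition _ := GRing.Algebra.on AJ.

Definition AJ_proj : U -> AJ := @alg_proj C U (ideal_gen_by gen_ideal_Z_proper).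
HB.instance Definition _ := GRing.RMorphism.on AJ_proj.

Lemma AJ_projZ a x : AJ_proj (a *: x) = a *: AJ_proj x.
Proof. exact: alg_projZ. Qed.

Lemma AJ_projP (x y : U) :
  AJ_proj x = AJ_proj y <-> exists b, x - y = b * (UZ + 2^-1 *: 1).
Proof.
rewrite /AJ_proj /alg_proj alg_quotP; split; first by move/asboolP/gen_ideal_Z.
case=> b ->; apply/asboolP/gen_idealMl; exact: gen_ideal_base.
Qed.

Definition AE : AJ := AJ_proj (U_E_nu C).
Definition AF : AJ := AJ_proj (U_F_nu C).
Definition Ae : AJ := AJ_proj Ue.
Definition Af : AJ := AJ_proj Uf.
Definition Ah : AJ := AJ_proj (U_H_nu C).

Lemma AJ_Z : AJ_proj UZ = - (2^-1 *: 1).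
Proof.
apply/eqP; rewrite -addr_eq0; apply/eqP.
have : AJ_proj (UZ + 2^-1 *: 1) = AJ_proj 0.
  by apply/AJ_projP; exists 1; rewrite mul1r subr0.
by rewrite rmorphD /= AJ_projZ /= rmorph1 rmorph0.
Qed.

Lemma Aef : Ae * Af = Af * Ae + 1.
Proof.
have [_ [[_ _ _ _ efE] _]] := UJ_relations C.
move/(congr1 AJ_proj): efE; rewrite rmorphB !rmorphM rmorphN /= AJ_projZ AJ_Z.
rewrite scalerN opprK scalerA divff ?scale1r ?pnatr_eq0 // => /eqP.
by rewrite subr_eq addrC => /eqP.
Qed.

Let E0 := AJ_proj UE.
Let F0 := AJ_proj UF.
Let H0 := AJ_proj UH.

Let lie_proj x y : lie (AJ_proj x) (AJ_proj y) = AJ_proj (x * y - y * x).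
Proof. by rewrite rmorphB !rmorphM. Qed.
Let projN x : AJ_proj (- x) = - AJ_proj x. Proof. exact: rmorphN. Qed.
Let proj0 : AJ_proj 0 = 0. Proof. exact: rmorph0. Qed.

Let sl2_rels :
  [/\ lie H0 E0 = 2 *: E0, lie H0 F0 = - (2 *: F0) & lie E0 F0 = H0].
Proof.
have [[HE HF EF _ _] _] := UJ_relations C.
by split; rewrite lie_proj ?HE ?HF ?EF ?projN ?AJ_projZ.
Qed.

Let mixed_rels : [/\ lie H0 Ae = Ae, lie H0 Af = - Af &
  [/\ lie E0 Ae = 0, lie E0 Af = - Ae, lie F0 Ae = - Af & lie F0 Af = 0]].
Proof.
have [[_ _ _ He Hf] [[Ee Ef Fe Ff _] _]] := UJ_relations C.
split; last split.
- by rewrite lie_proj He.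
- by rewrite lie_proj Hf projN.
- by rewrite lie_proj Ee proj0.
- by rewrite lie_proj Ef projN.
- by rewrite lie_proj Fe projN.
- by rewrite lie_proj Ff proj0.
Qed.

Let lie_ef : lie Ae Af = 1. Proof. by rewrite /lie Aef addrC addKr. Qed.

Let AEE : AE = E0 + 2^-1 *: Ae ^+ 2.
Proof. by rewrite /AE rmorphD /= AJ_projZ /= rmorphXn. Qed.
Let AFE : AF = F0 - 2^-1 *: Af ^+ 2.
Proof. by rewrite /AF rmorphB /= AJ_projZ /= rmorphXn. Qed.
Let AhE : Ah = H0 + Af * Ae + 2^-1 *: 1.
Proof. by rewrite /Ah !rmorphD /= AJ_projZ /= rmorphM rmorph1. Qed.

Lemma AE_commute : GRing.comm AE Ae /\ GRing.comm AE Af.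
Proof.
have [_ _ [Ee Ef _ _]] := mixed_rels.
by rewrite AEE; split; [exact: osc_comm_Ee|exact: osc_comm_Ef].
Qed.

Lemma AF_commute : GRing.comm AF Ae /\ GRing.comm AF Af.
Proof.
have [_ _ [_ _ Fe Ff]] := mixed_rels.
by rewrite AFE; split; [exact: osc_comm_Fe|exact: osc_comm_Ff].
Qed.

Lemma AEF : AE * AF = Ah + AF * AE.
Proof.
have [_ _ EF] := sl2_rels; have [_ _ [_ Ef Fe _]] := mixed_rels.
by rewrite AEE AFE AhE; exact: osc_lie_EF.
Qed.

Lemma AhE_shift : Ah * AE = AE * (Ah + 2%:R) /\ Ah * AF = AF * (Ah - 2%:R).
Proof.
have [HE HF _] := sl2_rels; have [He Hf [Ee Ef Fe Ff]] := mixed_rels.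
by rewrite AEE AFE AhE; split; [exact: osc_hE|exact: osc_hF].
Qed.

(** E_nu, F_nu, e and f suffice: they give back E and F, then H = [E, F], and
    Z is a scalar. *)
Lemma AJ_ind (P : AJ -> Prop) :
  P 1 -> (forall x y, P x -> P y -> P (x + y)) ->
  (forall a x, P x -> P (a *: x)) ->
  (forall x, P x -> [/\ P (AE * x), P (AF * x), P (Ae * x) & P (Af * x)]) ->
  forall x, P x.
Proof.
move=> P1 PD PZ PM x; have [u <-] : exists u, AJ_proj u = x by exact: alg_proj_surj.
have PE y : P y -> P (AE * y) by case/PM.
have PF y : P y -> P (AF * y) by case/PM.
have Pe y : P y -> P (Ae * y) by case/PM.
have Pf y : P y -> P (Af * y) by case/PM.
have PB y z : P y -> P z -> P (y - z).
  by move=> Py Pz; rewrite -scaleN1r; apply: PD => //; exact: PZ.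
have E0E : E0 = AE - 2^-1 *: Ae ^+ 2 by rewrite AEE addrK.
have F0E : F0 = AF + 2^-1 *: Af ^+ 2 by rewrite AFE subrK.
have PE0 y : P y -> P (E0 * y).
  move=> Py; rewrite E0E mulrBl -scalerAl expr2 -mulrA; apply: PB; first exact: PE.
  exact/PZ/Pe/Pe.
have PF0 y : P y -> P (F0 * y).
  move=> Py; rewrite F0E mulrDl -scalerAl expr2 -mulrA; apply: PD; first exact: PF.
  exact/PZ/Pf/Pf.
elim/UJ_ind: u => [|y z Py Pz|a y Py|b y Py].
- by rewrite rmorph1.
- by rewrite rmorphD; exact: PD.
- by rewrite AJ_projZ; exact: PZ.
rewrite rmorphM; case: b => /=.
- have [_ _ HE0] := sl2_rels; rewrite -[AJ_proj UH]HE0 /lie mulrBl -!mulrA.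
  by apply: PB; [exact/PE0/PF0|exact/PF0/PE0].
- exact: PE0.
- exact: PF0.
- exact: Pe.
- exact: Pf.
- by rewrite AJ_Z mulNr -scalerAl mul1r -scaleN1r; exact/PZ/PZ.
Qed.

Lemma AhE_H : AJ_proj UH = Ah - Af * Ae - 2^-1 *: 1.
Proof. by rewrite AhE -addrA -opprD -(addrA H0) addrK. Qed.

Section Weight.
Variable k : C.
Local Notation D := (DJ k).

Definition DJ_proj : UJk C -> D := @alg_proj C (UJk C) (ideal_k k).

(** Multiples of Z + 1/2 lie in the left ideal defining D_k, so computations in
    D_k may be carried out in [AJ]. *)
Lemma DJ_projP (u v : UJk C) :
  AJ_proj (val u) = AJ_proj (val v) -> DJ_proj u = DJ_proj v.
Proof.
move=> /AJ_projP[b uvE]; apply/alg_quotP/asboolP.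
by exists 0, b; rewrite rmorphB /= uvE mul0r add0r.
Qed.

Let comm_UX : U_E_nu C * Uf ^+ 2 \in commutant [:: UH; UZ].
Proof.
apply: ad_weight0P; rewrite -[0](subrr (1 + 1)) opprD.
apply: ad_weightM; first exact: weight_k_E_nu.
by rewrite expr2; apply: ad_weightM; exact: (weight_k_gen C jf).
Qed.

Let comm_UY : U_F_nu C * Ue ^+ 2 \in commutant [:: UH; UZ].
Proof.
apply: ad_weight0P; rewrite -[0](addNr (1 + 1)) opprD.
apply: ad_weightM; first exact: weight_k_F_nu.
by rewrite expr2; apply: ad_weightM; exact: (weight_k_gen C je).
Qed.

Let comm_Uh : U_H_nu C \in commutant [:: UH; UZ].
Proof. exact/ad_weight0P/weight_k_H_nu. Qed.

Let comm_Uw : Uf * Ue \in commutant [:: UH; UZ].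
Proof. exact/ad_weight0P/weight_k_fe. Qed.

Definition UX : UJk C := exist _ (U_E_nu C * Uf ^+ 2) comm_UX.
Definition UY : UJk C := exist _ (U_F_nu C * Ue ^+ 2) comm_UY.
Let Uh : UJk C := exist _ (U_H_nu C) comm_Uh.
Let Uw : UJk C := exist _ (Uf * Ue) comm_Uw.
Let UC : UJk C := exist _ (U_calC C) (U_calC_commutant C).

Definition DX : D := DJ_proj UX.
Definition DY : D := DJ_proj UY.
(** The class of H_nu, whose eigenvalues are the weights. *)
Definition Dh : D := calE k + k *: 1.

Let projD u v : DJ_proj (u + v) = DJ_proj u + DJ_proj v.
Proof. exact: alg_projD. Qed.
Let projB u v : DJ_proj (u - v) = DJ_proj u - DJ_proj v.
Proof. exact: alg_projB. Qed.
Let projM u v : DJ_proj (u * v) = DJ_proj u * DJ_proj v.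
Proof. exact: alg_projM. Qed.
Let projZ a u : DJ_proj (a *: u) = a *: DJ_proj u.
Proof. exact: alg_projZ. Qed.
Let proj1 : DJ_proj 1 = 1.
Proof. exact: alg_proj1. Qed.
Let projn n : DJ_proj n%:R = n%:R.
Proof. by rewrite -scaler_nat projZ proj1 scaler_nat. Qed.

Let q (u : UJk C) : AJ := AJ_proj (val u).
Let qD u v : q (u + v) = q u + q v. Proof. by rewrite /q !rmorphD. Qed.
Let qB u v : q (u - v) = q u - q v. Proof. by rewrite /q !rmorphB. Qed.
Let qM u v : q (u * v) = q u * q v. Proof. by rewrite /q !rmorphM. Qed.
Let qZ a u : q (a *: u) = a *: q u. Proof. exact: AJ_projZ. Qed.
Let q1 : q 1 = 1. Proof. exact: rmorph1. Qed.
Let qn n : q n%:R = n%:R. Proof. by rewrite /q !rmorph_nat. Qed.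
Let qX : q UX = AE * Af ^+ 2. Proof. by rewrite /q /= !expr2 !rmorphM. Qed.
Let qY : q UY = AF * Ae ^+ 2. Proof. by rewrite /q /= !expr2 !rmorphM. Qed.
Let qw : q Uw = Af * Ae. Proof. exact: rmorphM. Qed.
Let qh : q Uh = Ah. Proof. by []. Qed.
Let qC : q UC = Ah ^+ 2 + 2 *: Ah + 4 *: (AF * AE).
Proof. by rewrite /q /= /U_calC !expr2 !rmorphD /= !AJ_projZ !rmorphM. Qed.
Let qE := (qn, qD, qB, qM, qZ, q1, qX, qY, qw, qh, qC).

Let calEE : calE k = DJ_proj (Uw + 2^-1 *: 1).
Proof.
apply: DJ_projP; rewrite /= /U_calE AJ_projZ !rmorphD !rmorphM /= AJ_projZ rmorph1.
rewrite [AJ_proj Ue * AJ_proj Uf]Aef addrA scalerDr; congr (_ + _).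
by rewrite -mulr2n -scaler_nat scalerA mulVf ?scale1r // pnatr_eq0.
Qed.

Let DwE : DJ_proj Uw = Dh - k *: 1 - 2^-1 *: 1.
Proof. by rewrite /Dh addrK calEE projD projZ proj1 addrK. Qed.

Let comm_UH : UH \in commutant [:: UH; UZ].
Proof. by apply: ad_weight0P; exact: (weight_k_gen C jH). Qed.

Let DhE : Dh = DJ_proj Uh.
Proof.
pose UH' : UJk C := exist _ UH comm_UH.
have -> : Uh = UH' + Uw + 2^-1 *: 1 by apply: val_inj.
have projH : DJ_proj UH' = k *: 1.
  rewrite -proj1 -projZ; apply/alg_quotP/asboolP.
  by exists 1, 0; rewrite mul0r addr0 mul1r.
by rewrite /Dh calEE !projD projH addrC addrA.
Qed.

Lemma DJ_hX : Dh * DX = DX * (Dh + 2%:R).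
Proof.
rewrite DhE -projn -projD -!projM; apply: DJ_projP; rewrite -!/(q _) !qE.
have [hE _] := AhE_shift; have [_ Ef] := AE_commute; have [_ Ff] := AF_commute.
exact: sl2_weyl_hX hE AEF Ef Ff.
Qed.

Lemma DJ_hY : Dh * DY = DY * (Dh - 2%:R).
Proof.
rewrite DhE -projn -projB -!projM; apply: DJ_projP; rewrite -!/(q _) !qE.
have [_ hF] := AhE_shift; have [Ee _] := AE_commute; have [Fe _] := AF_commute.
exact: sl2_weyl_hY hF AEF Ee Fe.
Qed.

Let Dw_shift b : DJ_proj Uw + b *: 1 = Dh + (b - k - 2^-1) *: 1.
Proof.
have aux (V : zmodType) (x y z t : V) : x - y - z + t = x + (t - y - z).
  by rewrite -!addrA; congr (_ + _); rewrite addrA addrC.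
by rewrite DwE aux !scalerBl.
Qed.

Let calCE : calC k = DJ_proj UC. Proof. by []. Qed.

(** Here f e is read as [Dh - k - 1/2], which holds only modulo H - k. *)
Lemma DJ_YX : 4 *: (DY * DX) = (calC k - Dh * (Dh + 2%:R)) *
  ((Dh + (2^-1 - k) *: 1) * (Dh + (3 / 2 - k) *: 1)).
Proof.
have -> : Dh + (2^-1 - k) *: 1 = DJ_proj Uw + 1.
  by rewrite -[1 in RHS]scale1r Dw_shift; congr (_ + _ *: _); field.
have -> : Dh + (3 / 2 - k) *: 1 = DJ_proj Uw + 2%:R.
  by rewrite -[2%:R in RHS]scaler_nat Dw_shift; congr (_ + _ *: _); field.
rewrite DhE calCE -projn -proj1 -!projD -!projM -projB -projM -projZ.
apply: DJ_projP; rewrite -!/(q _) !qE.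
by apply: sl2_weyl_YX; rewrite ?Aef //; case: AE_commute.
Qed.

Lemma DJ_XY : 4 *: (DX * DY) = (calC k - Dh * (Dh - 2%:R)) *
  ((Dh - (2^-1 + k) *: 1) * (Dh - (3 / 2 + k) *: 1)).
Proof.
have -> : Dh - (2^-1 + k) *: 1 = DJ_proj Uw.
  rewrite -[RHS]addr0 -(scale0r 1) Dw_shift -scaleNr.
  by congr (_ + _ *: _); ring.
have -> : Dh - (3 / 2 + k) *: 1 = DJ_proj Uw - 1.
  by rewrite -[- 1 in RHS]scaleN1r Dw_shift -scaleNr; congr (_ + _ *: _); field.
rewrite DhE calCE -projn -proj1 -!projB -!projM -projB -projM -projZ.
apply: DJ_projP; rewrite -!/(q _) !qE.
apply: sl2_weyl_XY; rewrite ?Aef //; first exact: AEF.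
by case: AF_commute.
Qed.

(** D_k is generated by [calE], [calC], [DX] and [DY]: the image of U(g)^k in
    [AJ] commutes with H, so [commutant_gen] applies, and w is affine in [Dh]. *)
Lemma DJ_ind (P : D -> Prop) :
  (forall a, P (a *: 1)) -> P (calE k) -> P (calC k) -> P DX -> P DY ->
  (forall x y, P x -> P y -> P (x + y)) ->
  (forall x y, P x -> P y -> P (x * y)) -> forall x, P x.
Proof.
move=> P1 PE PC PX PY PD PM x; have [u <-] := alg_proj_surj x.
have [hE hF] := AhE_shift.
have [Ee Ef] := AE_commute; have [Fe Ff] := AF_commute.
have Hu : GRing.comm (Ah - Af * Ae - 2^-1 *: 1) (AJ_proj (val u)).
  have /commutantP/(_ UH (mem_head _ _)) := valP u.
  by rewrite -AhE_H => /(congr1 AJ_proj); rewrite !rmorphM.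
have span := spanned_all hE hF AEF erefl Aef Ee Ef Fe Ff AJ_ind.
have := commutant_gen hE hF AEF erefl Aef Ee Ef Fe Ff span Hu.
set S := (X in gen_subalg X _).
suff gen y : gen_subalg S y -> exists2 v, AJ_proj (val v) = y & P (DJ_proj v).
  by move=> /gen[v /esym/DJ_projP uv]; rewrite -/(DJ_proj u) uv.
have Pk : P Dh by exact: PD.
elim: y / => [y [[-> | -> | ->] | -> | ->]|a|y z _ [v <- Pv] _ [t <- Pt]|].
- by exists Uh; rewrite // -DhE.
- exists Uw; first by rewrite rmorphM.
  by rewrite DwE -!scaleNr; apply: (PD) => //; apply: PD.
- exists UC; last exact: PC.
  exact: qC.
- by exists UX; rewrite // -/(q _) qX.
- by exists UY; rewrite // -/(q _) qY.
- exists (a *: 1); first by rewrite /= AJ_projZ rmorph1.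
  by rewrite /DJ_proj alg_projZ alg_proj1.
- exists (v + t); first exact: qD.
  by rewrite /DJ_proj alg_projD; exact: PD.
move=> y z _ [v <- Pv] _ [t <- Pt]; exists (v * t); first exact: qM.
by rewrite /DJ_proj alg_projM; exact: PM.
Qed.

End Weight.
End Reduction.

(** * Construction of the characters *)

(** [top_weight k c mu] says that the polynomial giving 4 Y X vanishes at C = c,
    h = mu, so that mu can be a highest weight, and [bottom_weight k c mu] says
    the same of 4 X Y and lowest weights. *)
Definition top_weight (C : numClosedFieldType) (k c mu : C) : Prop :=
  (c + 1 - (mu + 1) ^+ 2) * ((mu - k + 1 / 2) * (mu - k + 3 / 2)) = 0.
Definition bottom_weight (C : numClosedFieldType) (k c mu : C) : Prop :=
  (c + 1 - (mu - 1) ^+ 2) * ((mu - k - 1 / 2) * (mu - k - 3 / 2)) = 0.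

Section WeightModule.
Variables (C : numClosedFieldType) (k c mu : C).
Local Notation U := (UJ C).
Local Notation UH := (Ugen C jH).
Local Notation UZ := (Ugen C jZ).
Local Notation M := (int -> int -> C^o).

(* [a] gives the point (0, 0) the H-weight k, and with [q] as the coefficient of
   F_nu the Casimir element acts by [c]. *)
Let a := mu - k - 2^-1.
Let q (i : int) : C := (c + 1 - (mu + 2 * i%:~R - 1) ^+ 2) / 4.

Definition wm_e (g : M) : M := fun i j => (a + j%:~R + 1) * g i (j + 1).
Definition wm_f (g : M) : M := fun i j => g i (j - 1).
(** A function g stands for the formal sum of the g i j v_i x^(a + j), where
    e = d/dx, f = x, and v_i spans the sl2-weight space of weight mu + 2 i:
    E_nu v_i = v_(i+1) and F_nu v_i = q i v_(i-1). *)
Definition wm_op (b : jacobi_basis) (g : M) : M :=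
  match b with
  | jH => fun i j => (k + 2 * i%:~R - j%:~R) * g i j
  | jE => fun i j => g (i - 1) j - 2^-1 * wm_e (wm_e g) i j
  | jF => fun i j => q (i + 1) * g (i + 1) j + 2^-1 * wm_f (wm_f g) i j
  | je => wm_e g
  | jf => wm_f g
  | jZ => fun i j => - 2^-1 * g i j
  end.

Lemma wm_op_linear b : linear (wm_op b).
Proof.
move=> x u v; apply/funext => i; apply/funext => j.
rewrite -[RHS]/(x * wm_op b u i j + wm_op b v i j).
by case: b => /=; rewrite /wm_e /wm_f -?[(x *: u + v) _ _]/(x * u _ _ + v _ _); ring.
Qed.

Local Notation act := (free_act wm_op).

Let actM x y v : act (x * y) v = act x (act y v).
Proof. by apply: free_actM; exact: wm_op_linear. Qed.

Let actr0 x : act x 0 = 0.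
Proof. by apply: free_act_0r; exact: wm_op_linear. Qed.

Lemma wm_relations r v : r \in jacobi_relations C -> act r v = 0.
Proof.
have fD (g h : M) i j : (g + h) i j = g i j + h i j by [].
have fN (g : M) i j : (- g) i j = - g i j by [].
have fZ x (g : M) i j : (x *: g) i j = x * g i j by [].
have f0 i j : (0 : M) i j = 0 by [].
rewrite !inE => rels; apply/funext => i; apply/funext => j; move: rels.
do 14?[case/orP]; move=> /eqP ->.
all: rewrite !(free_actD, free_actN, free_actZ, actM, free_act_gen).
all: rewrite ?(fD, fN, fZ) f0 /=.
all: rewrite /wm_e /wm_f /q /a ?(addrK, subrK).
all: rewrite ?(rmorphD, rmorphB, rmorphN) /= ?rmorph1.
all: by field.
Qed.

Let lin := wm_op_linear.

Lemma wm_gen_ideal r v :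
  gen_ideal (fun x => x \in jacobi_relations C) r -> act r v = 0.
Proof.
move=> rI; elim: rI v => {r} [r|v|x y _ IHx _ IHy v|x y _ IHy v|x y _ IHy v].
- by move=> rI v; exact: wm_relations.
- exact: free_act0.
- by rewrite free_actD IHx IHy addr0.
- by rewrite actM IHy actr0.
- by rewrite actM IHy.
Qed.

Definition wm_act (u : U) (g : M) : M := act (repr u) g.

Lemma wm_act_proj x g : wm_act (alg_proj _ x) g = act x g.
Proof.
apply/esym/eqP; rewrite -subr_eq0 -free_actB; apply/eqP/wm_gen_ideal.
have /alg_quotP/asboolP// : alg_proj (ideal_gen_by (@jacobi_relations_proper C)) x =
    alg_proj _ (repr (alg_proj (ideal_gen_by (@jacobi_relations_proper C)) x)).
by rewrite [RHS]/alg_proj reprK.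
Qed.

Lemma wm_actD u v g : wm_act (u + v) g = wm_act u g + wm_act v g.
Proof.
have [x <-] := alg_proj_surj u; have [y <-] := alg_proj_surj v.
by rewrite -alg_projD !wm_act_proj free_actD.
Qed.

Lemma wm_actZ b u g : wm_act (b *: u) g = b *: wm_act u g.
Proof.
by have [x <-] := alg_proj_surj u; rewrite -alg_projZ !wm_act_proj free_actZ.
Qed.

Lemma wm_actN u g : wm_act (- u) g = - wm_act u g.
Proof. by rewrite -scaleN1r wm_actZ scaleN1r. Qed.

Lemma wm_actB u v g : wm_act (u - v) g = wm_act u g - wm_act v g.
Proof. by rewrite wm_actD wm_actN. Qed.

Lemma wm_actM u v g : wm_act (u * v) g = wm_act u (wm_act v g).
Proof.
have [x <-] := alg_proj_surj u; have [y <-] := alg_proj_surj v.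
by rewrite -alg_projM !wm_act_proj actM.
Qed.

Lemma wm_act1 g : wm_act 1 g = g.
Proof. by rewrite -(alg_proj1 (ideal_gen_by _)) wm_act_proj free_act1. Qed.

Lemma wm_act_gen b g : wm_act (Ugen C b) g = wm_op b g.
Proof. by rewrite wm_act_proj free_act_gen. Qed.

Lemma wm_act0r u : wm_act u 0 = 0.
Proof. exact: actr0. Qed.

Lemma wm_act_linear u : linear (wm_act u).
Proof.
move=> b g g'; rewrite /wm_act /free_act scaler_sumr -big_split /=.
apply: eq_bigr => m _.
by rewrite (word_act_linear lin m) scalerDr !scalerA mulrC.
Qed.

Let wm_actE := (wm_actD, wm_actZ, wm_actN, wm_actM, wm_act1, wm_act_gen).

Let addE (g h : M) i j : (g + h) i j = g i j + h i j. Proof. by []. Qed.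
Let oppE (g : M) i j : (- g) i j = - g i j. Proof. by []. Qed.
Let scaleE x (g : M) i j : (x *: g) i j = x * g i j. Proof. by []. Qed.
Let ptE := (addE, oppE, scaleE).

Lemma wm_E_nu g i j : wm_act (U_E_nu C) g i j = g (i - 1) j.
Proof. by rewrite /U_E_nu expr2 !wm_actE !ptE /= subrK. Qed.

Lemma wm_F_nu g i j : wm_act (U_F_nu C) g i j = q (i + 1) * g (i + 1) j.
Proof. by rewrite /U_F_nu expr2 !wm_actE !ptE /= addrK. Qed.

Lemma wm_H_nu g i j : wm_act (U_H_nu C) g i j = (mu + 2 * i%:~R) * g i j.
Proof.
rewrite /U_H_nu !wm_actE !ptE /= /wm_e /wm_f /a subrK rmorphB /= rmorph1.
by field.
Qed.

Lemma wm_X g i j : wm_act (val (UX C)) g i j = g (i - 1) (j - 2).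
Proof.
by rewrite /= expr2 !wm_actM wm_E_nu !wm_act_gen /= /wm_f -addrA -opprD.
Qed.

Lemma wm_Y g i j : wm_act (val (UY C)) g i j =
  q (i + 1) * ((a + j%:~R + 1) * (a + j%:~R + 2)) * g (i + 1) (j + 2).
Proof.
rewrite /= expr2 !wm_actM wm_F_nu !wm_act_gen /= /wm_e.
have -> : j + 2 = j + 1 + 1 by rewrite -addrA.
by rewrite rmorphD /= rmorph1; ring.
Qed.

Lemma wm_calE g i j : wm_act (U_calE C) g i j = (a + j%:~R + 2^-1) * g i j.
Proof.
rewrite /U_calE !wm_actE !ptE /= /wm_e /wm_f subrK addrK rmorphB /= rmorph1.
by field.
Qed.

Lemma wm_calC g : wm_act (U_calC C) g = c *: g.
Proof.
apply/funext => i; apply/funext => j; rewrite scaleE.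
have actC x y z : wm_act (x ^+ 2 + 2 *: x + 4 *: (y * z)) g =
    wm_act x (wm_act x g) + 2 *: wm_act x g + 4 *: wm_act y (wm_act z g).
  by rewrite expr2 !wm_actE.
rewrite [U_calC C]/(_ + _) actC !ptE !wm_H_nu wm_F_nu wm_E_nu addrK.
by rewrite /q rmorphD /= rmorph1; field.
Qed.

(** The point (i, j) has H-weight k + 2 i - j, so the points (i, 2 i) make up the
    weight space on which U(g)^k acts through D_k ([wm_supp_ideal]). *)
Definition wm_supp (n : int) (g : M) : Prop :=
  forall i j, ~~ ((j == 2 * i) && (n <= i)) -> g i j = 0.

Lemma wm_suppD n g g' : wm_supp n g -> wm_supp n g' -> wm_supp n (g + g').
Proof. by move=> gn gn' i j ij; rewrite addE gn // gn' // addr0. Qed.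

Lemma wm_suppZ n b g : wm_supp n g -> wm_supp n (b *: g).
Proof. by move=> gn i j ij; rewrite scaleE gn // mulr0. Qed.

Lemma wm_supp_ideal n g u v : DJ_proj k u = DJ_proj k v -> wm_supp n g ->
  wm_act (val u) g = wm_act (val v) g.
Proof.
move=> /alg_quotP/asboolP[x [y xyE]] gn.
have uvE : val u = x * (UH - k *: 1) + y * (UZ + 2^-1 *: 1) + val v.
  by rewrite -xyE rmorphB /= subrK.
have gH : wm_act (UH - k *: 1) g = 0.
  rewrite wm_actB wm_actZ wm_act1 wm_act_gen.
  apply/funext => i; apply/funext => j; rewrite !ptE /=.
  have [/andP[/eqP -> _]|/gn ->] := boolP ((j == 2 * i) && (n <= i)).
    by rewrite rmorphM /= addrK subrr.
  by rewrite !mulr0 subrr.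
have gZ : wm_act (UZ + 2^-1 *: 1) g = 0.
  rewrite wm_actD wm_actZ wm_act1 wm_act_gen.
  by apply/funext => i; apply/funext => j; rewrite !ptE /= mulNr addNr.
by rewrite uvE 2!wm_actD (wm_actM x) (wm_actM y) gH gZ !wm_act0r !add0r.
Qed.

Hypotheses (top_mu : top_weight k c mu) (bottom_mu : bottom_weight k c mu).

Let stable u := forall n g, n \in [:: 0; 1 : int] -> wm_supp n g ->
  wm_supp n (wm_act u g).

(** By [DJ_ind] only X and Y matter: X raises [i], and Y lowers it with a
    coefficient that vanishes from [i = n] to [i = n - 1]. *)
Lemma wm_stable (u : UJk C) : stable (val u).
Proof.
suff H x : exists2 v, DJ_proj k v = x & stable (val v).
  have [v vu vS] := H (DJ_proj k u) => n g n01 gn.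
  by rewrite -(wm_supp_ideal vu gn); exact: vS.
elim/DJ_ind: x => [b|||||x y [u1 <- S1] [u2 <- S2]|x y [u1 <- S1] [u2 <- S2]].
- exists (b *: 1); first by rewrite /DJ_proj alg_projZ alg_proj1.
  by move=> n g _ gn; rewrite wm_actZ wm_act1; exact: wm_suppZ.
- eexists; first by [].
  by move=> n g _ gn i j /gn g0; rewrite wm_calE g0 mulr0.
- eexists; first by [].
  by move=> n g _ gn; rewrite wm_calC; exact: wm_suppZ.
- exists (UX C) => // n g _ gn i j ij; rewrite wm_X gn //; apply: contra ij.
  by lia.
- exists (UY C) => // n g n01 gn i j ij; rewrite wm_Y.
  have [/andP[/eqP jE ni]|/gn ->] := boolP ((j + 2 == 2 * (i + 1)) && (n <= i + 1));
    last by rewrite mulr0.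
  have {}jE : j = 2 * i by lia.
  have iE : i = n - 1 by move: ij; rewrite jE; lia.
  rewrite jE iE subrK; move: n01; rewrite !inE => /orP[] /eqP ->.
    have -> : q 0 * ((a + (2 * (0 - 1))%:~R + 1) * (a + (2 * (0 - 1))%:~R + 2)) =
        4^-1 * ((c + 1 - (mu - 1) ^+ 2) * ((mu - k - 1 / 2) * (mu - k - 3 / 2))).
      by rewrite /q /a; field.
    by rewrite bottom_mu mulr0 mul0r.
  have -> : q 1 * ((a + (2 * (1 - 1))%:~R + 1) * (a + (2 * (1 - 1))%:~R + 2)) =
      4^-1 * ((c + 1 - (mu + 1) ^+ 2) * ((mu - k + 1 / 2) * (mu - k + 3 / 2))).
    by rewrite /q /a; field.
  by rewrite top_mu mulr0 mul0r.
- exists (u1 + u2); first by rewrite /DJ_proj alg_projD.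
  by move=> n g n01 gn; rewrite wm_actD; apply: wm_suppD; [exact: S1|exact: S2].
- exists (u1 * u2); first by rewrite /DJ_proj alg_projM.
  by move=> n g n01 gn; rewrite wm_actM; apply: (S1) => //; exact: S2.
Qed.

Definition wm_delta : M := fun i j => ((i == 0) && (j == 0))%:R.

Lemma wm_delta_supp : wm_supp 0 wm_delta.
Proof.
move=> i j; rewrite /wm_delta; have [->|//] := eqVneq i 0.
by rewrite mulr0 lexx andbT => /negPf ->.
Qed.

Definition wm_char (x : DJ k) : C^o := wm_act (val (repr x)) wm_delta 0 0.

Lemma wm_charE u : wm_char (DJ_proj k u) = wm_act (val u) wm_delta 0 0.
Proof.
rewrite /wm_char (wm_supp_ideal (v := u) _ wm_delta_supp) //.
exact: reprK.
Qed.

Lemma wm_char_linear : linear wm_char.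
Proof.
move=> b x y; have [u <-] := alg_proj_surj x; have [v <-] := alg_proj_surj y.
rewrite -alg_projZ -alg_projD -!/(DJ_proj k _) !wm_charE.
by rewrite rmorphD /= wm_actD wm_actZ.
Qed.

(** Modulo [wm_supp 1], which D_k preserves, the space [wm_supp 0] is the line
    of [wm_delta]. *)
Lemma wm_act_corner (u : UJk C) g : wm_supp 0 g ->
  wm_act (val u) g 0 0 = g 0 0 * wm_act (val u) wm_delta 0 0.
Proof.
move=> g0; pose g' := g - g 0 0 *: wm_delta.
have g1 : wm_supp 1 g'.
  move=> i j ij; rewrite /g' !ptE /wm_delta.
  have [->|i0] := eqVneq i 0; have [->|j0] := eqVneq j 0 => /=.
  - by rewrite mulr1 subrr.
  - by rewrite mulr0 subr0 g0 // mulr0 (negPf j0).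
  - by rewrite mulr0 subr0 g0 // eq_sym mulf_eq0 (negPf i0).
  rewrite mulr0 subr0 g0 //; apply: contra ij => /andP[-> i_ge0] /=.
  by rewrite -gtz0_ge1 lt_def i0.
have z : wm_act (val u) g' 0 0 = 0 by apply: (wm_stable u _ g1).
have gE : g = g 0 0 *: wm_delta + g' by rewrite addrC subrK.
transitivity (wm_act (val u) (g 0 0 *: wm_delta + g') 0 0); first by rewrite -gE.
rewrite (wm_act_linear (val u) (g 0 0) wm_delta g').
by rewrite addE scaleE z addr0.
Qed.

Lemma wm_charM : monoid_morphism wm_char.
Proof.
split.
  by rewrite -(alg_proj1 (ideal_k k)) -/(DJ_proj k _) wm_charE rmorph1 wm_act1.
move=> x y; have [u <-] := alg_proj_surj x; have [v <-] := alg_proj_surj y.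
rewrite -alg_projM -!/(DJ_proj k _) !wm_charE rmorphM wm_actM mulrC.
by apply/wm_act_corner/wm_stable; [|exact: wm_delta_supp].
Qed.

End WeightModule.

Lemma exists_character (C : numClosedFieldType) (k c mu : C) :
  top_weight k c mu -> bottom_weight k c mu ->
  exists chi : {lrmorphism DJ k -> C^o}, chi (calC k) = c /\ chi (Dh k) = mu.
Proof.
move=> top bot.
pose chi0 : DJ k -> C^o := wm_char c mu.
pose chiL := GRing.isLinear.Build C (DJ k) C^o *:%R chi0 (wm_char_linear c mu).
pose chiM := GRing.isMonoidMorphism.Build (DJ k) C^o chi0 (wm_charM top bot).
pose chi : {lrmorphism DJ k -> C^o} := HB.pack chi0 chiL chiM.
exists chi; split.
  rewrite /= /chi0 -[calC k]/(DJ_proj k _) wm_charE wm_calC.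
  by rewrite [LHS]mulr1.
rewrite /Dh linearD linearZ rmorph1 /= /chi0 -[calE k]/(DJ_proj k _) wm_charE.
by rewrite wm_calE; rewrite /wm_delta /= -[k *: 1]/(k * 1); field.
Qed.

(** * Representations and characters of D_k *)

Section Characters.
Variables (C : numClosedFieldType) (k : C).
Local Notation D := (DJ k).
Implicit Types (c mu : C) (V : representation D).

Lemma shift_eq0 (s t : C) (b : C) : b != 0 -> s * t = t * (s + b) -> t = 0.
Proof.
move=> b0 /eqP; rewrite mulrDr mulrC -subr_eq0 opprD addNKr oppr_eq0 mulf_eq0.
by rewrite (negPf b0) orbF => /eqP.
Qed.

Let two_neq0 : 2 != 0 :> C. Proof. by rewrite pnatr_eq0. Qed.

Lemma character_DX (chi : {lrmorphism D -> C^o}) : chi (DX k) = 0.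
Proof.
have := congr1 chi (DJ_hX k); rewrite !rmorphM (rmorphD chi (Dh k)) (rmorph_nat chi 2).
exact: shift_eq0.
Qed.

Lemma character_DY (chi : {lrmorphism D -> C^o}) : chi (DY k) = 0.
Proof.
have := congr1 chi (DJ_hY k); rewrite !rmorphM (rmorphB chi (Dh k)) (rmorph_nat chi 2).
by apply: shift_eq0; rewrite oppr_eq0.
Qed.

Lemma character_scalar (chi : {lrmorphism D -> C^o}) a : chi (a *: 1) = a.
Proof. by rewrite linearZ rmorph1; exact: mulr1. Qed.

Lemma character_calE (chi : {lrmorphism D -> C^o}) : chi (calE k) = chi (Dh k) - k.
Proof. by rewrite /Dh (rmorphD chi) /= character_scalar addrK. Qed.

(** A character vanishes on [DX] and [DY], which shift [Dh]. *)
Lemma character_ext (chi chi' : {lrmorphism D -> C^o}) :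
  chi (calC k) = chi' (calC k) -> chi (Dh k) = chi' (Dh k) -> chi =1 chi'.
Proof.
move=> eqC eqh; elim/DJ_ind => [a|||||x y eqx eqy|x y eqx eqy].
- by rewrite !character_scalar.
- by rewrite !character_calE eqh.
- exact: eqC.
- by rewrite !character_DX.
- by rewrite !character_DY.
- by rewrite (rmorphD chi) (rmorphD chi') /= eqx eqy.
- by rewrite (rmorphM chi) (rmorphM chi') /= eqx eqy.
Qed.

Lemma repD V (x y : D) (v : V) : rep_op (x + y) v = rep_op x v + rep_op y v.
Proof. by have := rep_op_linear_l v 1 x y; rewrite !scale1r. Qed.

Lemma repZ V a (x : D) (v : V) : rep_op (a *: x) v = a *: rep_op x v.
Proof.
have rep0 : rep_op 0 v = 0 :> V.
  by apply: (addIr (rep_op 0 v)); rewrite -repD !addr0 add0r.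
by have := rep_op_linear_l v a x 0; rewrite rep0 !addr0.
Qed.

Lemma repB V (x y : D) (v : V) : rep_op (x - y) v = rep_op x v - rep_op y v.
Proof.
have -> : - y = -1 *: y by rewrite scaleN1r.
by rewrite repD repZ scaleN1r.
Qed.

Lemma repn V n (v : V) : rep_op (n%:R : D) v = n%:R *: v.
Proof.
have -> : n%:R = n%:R *: 1 :> D by rewrite scaler_nat.
by rewrite repZ rep_op1.
Qed.

Lemma repDr V (x : D) (u v : V) : rep_op x (u + v) = rep_op x u + rep_op x v.
Proof. by have := rep_op_linear x 1 u v; rewrite !scale1r. Qed.

Lemma rep0r V (x : D) : rep_op x (0 : V) = 0.
Proof. by apply: (addIr (rep_op x 0)); rewrite -repDr !addr0 add0r. Qed.

Lemma repZr V a (x : D) (v : V) : rep_op x (a *: v) = a *: rep_op x v.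
Proof. by have := rep_op_linear x a v 0; rewrite rep0r !addr0. Qed.

Definition repE := (repD, repB, repZ, repn, rep_opM, rep_op1, repZr).

Lemma rep_Dh V (v : V) : rep_op (Dh k) v = rep_op (calE k) v + k *: v.
Proof. by rewrite /Dh !repE. Qed.

Lemma eigen_shift V (x : D) (b mu : C) (v : V) :
  (forall u : V, rep_op (Dh k) u = mu *: u) -> b != 0 ->
  Dh k * x = x * (Dh k + b *: 1) -> rep_op x v = 0.
Proof.
move=> hmu b0 /(congr1 (fun y => rep_op y v)); rewrite !rep_opM !hmu.
rewrite repD repZ rep_op1 hmu -scalerDl repZr scalerDl => /eqP.
by rewrite -[X in X == _]addr0 (inj_eq (addrI _)) eq_sym scaler_eq0 (negPf b0) => /eqP.
Qed.

Lemma rep_DX0 V (mu : C) (v : V) :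
  (forall u : V, rep_op (Dh k) u = mu *: u) -> rep_op (DX k) v = 0.
Proof.
by move=> hmu; apply: (eigen_shift (b := 2) _ hmu) => //; rewrite scaler_nat; exact: DJ_hX.
Qed.

Lemma rep_DY0 V (mu : C) (v : V) :
  (forall u : V, rep_op (Dh k) u = mu *: u) -> rep_op (DY k) v = 0.
Proof.
move=> hmu; apply: (eigen_shift (b := - 2) _ hmu); first by rewrite oppr_eq0.
by rewrite scaleNr scaler_nat; exact: DJ_hY.
Qed.

Definition acts_through V (chi : {lrmorphism D -> C^o}) : Prop :=
  forall (x : D) (v : V), rep_op x v = chi x *: v.

(** [DX] and [DY] shift the only eigenvalue of [Dh], hence act by 0, so the four
    generators act by scalars. *)
Lemma scalar_action V (chi : {lrmorphism D -> C^o}) :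
  (forall v : V, rep_op (calC k) v = chi (calC k) *: v) ->
  (forall v : V, rep_op (Dh k) v = chi (Dh k) *: v) -> acts_through V chi.
Proof.
move=> actC acth x; elim/DJ_ind: x => [a|||||x y IHx IHy|x y IHx IHy] v.
- by rewrite repZ rep_op1 character_scalar.
- by rewrite character_calE scalerBl -acth rep_Dh addrK.
- exact: actC.
- by rewrite (rep_DX0 v acth) character_DX scale0r.
- by rewrite (rep_DY0 v acth) character_DY scale0r.
- by rewrite repD (rmorphD chi) /= scalerDl IHx IHy.
- by rewrite rep_opM (rmorphM chi) /= IHx IHy !scalerA.
Qed.

(** An isomorphism onto the line transports the scalars; conversely the
    coordinate along a basis vector is an isomorphism. *)
Lemma character_rep_equivalent V (chi : {lrmorphism D -> C^o}) :
  equivalent V (character_rep chi) <-> one_dimensional V /\ acts_through V chi.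
Proof.
split=> [[phi [[psi phiK psiK] phiM]]|[[v v0 spanv] act]].
  split; last by move=> x v; apply: (can_inj phiK); rewrite phiM linearZ.
  exists (psi 1).
    apply/eqP => psi0; have /eqP := psiK 1.
    by rewrite psi0 linear0 eq_sym oner_eq0.
  move=> w; exists (phi w); apply: (can_inj phiK).
  by rewrite linearZ psiK -[RHS]/(phi w * 1) mulr1.
have scaleI a b : a *: v = b *: v -> a = b.
  by move/eqP; rewrite -subr_eq0 -scalerBl scaler_eq0 (negPf v0) orbF subr_eq0 => /eqP.
pose phi0 w : C^o := projT1 (cid (spanv w)).
have phi0E w : w = phi0 w *: v by rewrite /phi0; case: cid.
have phi0_linear : linear phi0.
  move=> a u w; apply: scaleI.
  by rewrite -phi0E scalerDl -[a *: phi0 u]/(a * phi0 u) -scalerA -!phi0E.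
pose phi : {linear V -> C^o} :=
  HB.pack phi0 (GRing.isLinear.Build C V C^o *:%R phi0 phi0_linear).
exists phi; split.
  exists (fun a : C^o => a *: v) => [w|a]; first by rewrite /= -phi0E.
  by apply: scaleI; rewrite /= -phi0E.
move=> x w; apply: scaleI; rewrite /= -phi0E act {1}[w]phi0E scalerA.
by [].
Qed.

(** Under the two conditions mu itself belongs to both sets that bound the
    weights, as the term with index 0. *)
Lemma Delta_point c mu : top_weight k c mu -> bottom_weight k c mu -> Delta k c mu = [set mu]%classic.
Proof.
have sq (t : C) : (c + 1 - t ^+ 2 == 0) = (t == sqrtC (c + 1)) || (t == - sqrtC (c + 1)).
  by rewrite subr_eq0 -{1}(sqrtCK (c + 1)) eq_sym eqf_sqr.
move=> /eqP top /eqP bot.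
have minM : is_min (Mplus k c mu) 0%:E%E.
  split; last first.
    move=> _ [->|[n [n0 _] <-]]; first exact: leey.
    by rewrite lee_fin.
  right; exists 0 => //; split=> //; rewrite mulr0 addr0.
  move: top; rewrite !mulf_eq0 sq => /orP[/orP[]|/orP[]] /eqP tE; rewrite !inE.
  - have <- : mu = - 1 + sqrtC (c + 1) by rewrite -tE; ring.
    by rewrite eqxx !orbT.
  - have <- : mu = - 1 - sqrtC (c + 1) by rewrite -[in LHS](addrK 1 mu) tE; ring.
    by rewrite eqxx !orbT.
  - have <- : mu = k - 1 / 2 by apply/eqP; rewrite -subr_eq0 -tE; apply/eqP; ring.
    by rewrite eqxx.
  - have <- : mu = k - 3 / 2 by apply/eqP; rewrite -subr_eq0 -tE; apply/eqP; ring.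
    by rewrite eqxx !orbT.
have maxM : is_max (Mminus k c mu) 0%:E%E.
  split; last first.
    move=> _ [->|[n [n0 _] <-]]; first exact: leNye.
    by rewrite lee_fin.
  right; exists 0 => //; split=> //; rewrite mulr0 addr0.
  move: bot; rewrite !mulf_eq0 sq => /orP[/orP[]|/orP[]] /eqP tE; rewrite !inE.
  - have <- : mu = 1 + sqrtC (c + 1) by rewrite -tE; ring.
    by rewrite eqxx !orbT.
  - have <- : mu = 1 - sqrtC (c + 1) by rewrite -[in LHS](subrK 1 mu) tE; ring.
    by rewrite eqxx !orbT.
  - have <- : mu = k + 1 / 2 by apply/eqP; rewrite -subr_eq0 -tE; apply/eqP; ring.
    by rewrite eqxx.
  - have <- : mu = k + 3 / 2 by apply/eqP; rewrite -subr_eq0 -tE; apply/eqP; ring.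
    by rewrite eqxx !orbT.
case: minM maxM => min1 min2 [max1 max2].
apply/seteqP; split=> [_ [n [a [b [[a1 a2] [b1 b2] an nb]]] <-]|_ ->].
  have aE : a = 0%:E%E by apply: le_anti; rewrite max2 // a2.
  have bE : b = 0%:E%E by apply: le_anti; rewrite min2 // b2.
  move: an nb; rewrite aE bE !lee_fin => n_ge0 n_le0.
  have -> : n = 0 by apply/eqP; rewrite eq_le n_le0.
  by rewrite /= mulr0 addr0.
exists 0; last by rewrite mulr0 addr0.
by exists 0%:E%E, 0%:E%E.
Qed.

(** All eigenvalues of [Dh] are mu, so semisimplicity makes [Dh] scalar; then
    every line is a subrepresentation. *)
Lemma is_Vk_acts_through c mu (chi : {lrmorphism D -> C^o}) V :
  top_weight k c mu -> bottom_weight k c mu -> chi (calC k) = c -> chi (Dh k) = mu ->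
  is_Vk c mu V -> one_dimensional V /\ acts_through V chi.
Proof.
move=> top bot chiC chih [irrV [ssV _] ccV wV].
have acth (v : V) : rep_op (Dh k) v = mu *: v.
  have [n [u [nu [uE ->]]]] := ssV v.
  rewrite scaler_sumr (big_morph (rep_op (Dh k)) (repDr _) (rep0r _ _)).
  apply: eq_bigr => i _; have [->|ui0] := eqVneq (u i) 0; first by rewrite rep0r scaler0.
  have : weights V (nu i + k).
    by exists (u i) => //; rewrite /eigenvectors /= (uE i) scalerDl.
  by rewrite wV Delta_point // => <-; rewrite rep_Dh (uE i) scalerDl.
have act : acts_through V chi by apply: scalar_action; rewrite ?chiC ?chih.
split=> //; case: irrV => -[v v0] irr; exists v => //.
have [|sub0|//] := irr [set w | exists a, w = a *: v]%classic.
  split=> [|a u w [b ->] [d ->]|x w [b ->]].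
  - by exists 0; rewrite scale0r.
  - by exists (a * b + d); rewrite scalerDl scalerA.
  - by exists (chi x * b); rewrite act scalerA.
by case/eqP: v0; apply: sub0; exists 1; rewrite scale1r.
Qed.

Lemma acts_through_is_Vk c mu (chi : {lrmorphism D -> C^o}) V :
  top_weight k c mu -> bottom_weight k c mu -> chi (calC k) = c -> chi (Dh k) = mu ->
  one_dimensional V -> acts_through V chi -> is_Vk c mu V.
Proof.
move=> top bot chiC chih [v v0 spanv] act; split.
- split; first by exists v.
  move=> W [W0 WD _]; have [Wv|nWv] := pselect (W v).
    right=> w; have [a ->] := spanv w.
    by rewrite -[a *: v]addr0; exact: WD.
  left=> w Ww; have [a wE] := spanv w; rewrite wE.
  have [->|a0] := eqVneq a 0; first by rewrite scale0r.
  case: nWv; have := WD a^-1 w 0 Ww W0.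
  by rewrite addr0 wE scalerA mulVf ?scale1r.
- split=> [w|nu].
    exists 1%N, (fun=> w), (fun=> chi (calE k)); split=> [i|]; last by rewrite big_ord1.
    exact: act.
  exists 1%N, (fun=> v) => w _; have [a ->] := spanv w.
  by exists (fun=> a); rewrite big_ord1.
- by move=> w; rewrite act chiC.
rewrite Delta_point //; apply/seteqP; split=> [nu [w w0]|_ ->].
  rewrite /eigenvectors /= -rep_Dh act chih => /eqP.
  by rewrite -subr_eq0 -scalerBl scaler_eq0 (negPf w0) orbF subr_eq0 => /eqP.
by exists v => //; rewrite /eigenvectors /= -rep_Dh act chih.
Qed.

(** As [DX] and [DY] act by 0 on a line, the relations for their products become
    the two conditions. The pair (c, lam) is replaced by (c, mu), where mu is the
    only weight. *)
Lemma one_dimensional_roots c lam V : is_Vk c lam V -> one_dimensional V ->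
  exists mu, [/\ top_weight k c mu, bottom_weight k c mu & is_Vk c mu V].
Proof.
move=> VV [v v0 spanv]; have [irrV admV ccV wV] := VV.
have [mu hv] := spanv (rep_op (Dh k) v).
have hmu (w : V) : rep_op (Dh k) w = mu *: w.
  by have [a ->] := spanv w; rewrite repZr hv !scalerA mulrC.
have scale0 a : a *: v = 0 -> a = 0.
  by move/eqP; rewrite scaler_eq0 (negPf v0) orbF => /eqP.
pose sc (x : D) s := forall w : V, rep_op x w = s *: w.
have scD x y s t : sc x s -> sc y t -> sc (x + y) (s + t).
  by move=> xs yt w; rewrite repD xs yt scalerDl.
have scB x y s t : sc x s -> sc y t -> sc (x - y) (s - t).
  by move=> xs yt w; rewrite repB xs yt scalerBl.
have scM x y s t : sc x s -> sc y t -> sc (x * y) (s * t).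
  by move=> xs yt w; rewrite rep_opM yt repZr xs scalerA mulrC.
have sc1 s : sc (s *: 1) s by move=> w; rewrite repZ rep_op1.
have scn n : sc n%:R n%:R by move=> w; rewrite repn.
have top : top_weight k c mu.
  apply: scale0; have := congr1 (fun x => rep_op x v) (DJ_YX k).
  rewrite repZ rep_opM (rep_DX0 v hmu) rep0r scaler0 => /esym.
  rewrite (scM _ _ _ _ (scB _ _ _ _ ccV (scM _ _ _ _ hmu (scD _ _ _ _ hmu (scn 2))))
    (scM _ _ _ _ (scD _ _ _ _ hmu (sc1 _)) (scD _ _ _ _ hmu (sc1 _)))) => <-.
  by congr (_ *: v); field.
have bot : bottom_weight k c mu.
  apply: scale0; have := congr1 (fun x => rep_op x v) (DJ_XY k).
  rewrite repZ rep_opM (rep_DY0 v hmu) rep0r scaler0 => /esym.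
  rewrite (scM _ _ _ _ (scB _ _ _ _ ccV (scM _ _ _ _ hmu (scB _ _ _ _ hmu (scn 2))))
    (scM _ _ _ _ (scB _ _ _ _ hmu (sc1 _)) (scB _ _ _ _ hmu (sc1 _)))) => <-.
  by congr (_ *: v); field.
exists mu; split=> //; split=> //; rewrite Delta_point //.
apply/seteqP; split=> [nu [w w0]|_ ->].
  rewrite /eigenvectors /= -rep_Dh hmu => /eqP.
  by rewrite -subr_eq0 -scalerBl scaler_eq0 (negPf w0) orbF subr_eq0 => /eqP.
by exists v => //; rewrite /eigenvectors /= -rep_Dh.
Qed.

(** Of the nine choices of a vanishing factor on each side, the four that take
    both factors from the oscillator part contradict each other. *)
Lemma roots_params c mu : top_weight k c mu -> bottom_weight k c mu ->
  exists i : 'I_5, tnth (one_dim_params k) i = (c, mu).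
Proof.
have absurd n Q : n.+1%:R = 0 - 0 :> C -> Q.
  by rewrite subr0 => /eqP; rewrite pnatr_eq0.
rewrite /top_weight /bottom_weight => /eqP top /eqP bot.
have pick n : (n < 5)%N -> nth (0, 0) (one_dim_params k) n = (c, mu) ->
    exists i : 'I_5, tnth (one_dim_params k) i = (c, mu).
  by move=> n5 pn; exists (Ordinal n5); rewrite (tnth_nth (0, 0)).
have cE t : c + 1 - t ^+ 2 = 0 -> c = t ^+ 2 - 1.
  by move/subr0_eq <-; rewrite addrK.
move: top; rewrite !mulf_eq0 => /orP[|/orP[]] /eqP topE;
  move: bot; rewrite !mulf_eq0 => /orP[|/orP[]] /eqP botE.
- have mu0 : mu = 0.
    apply: (mulfI (x := 4)); first by rewrite pnatr_eq0.
    by rewrite mulr0 -[RHS](subrr 0) -{1}botE -topE; ring.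
  apply: (pick 0%N) => //=.
  by rewrite (cE _ topE) mu0 add0r expr1n subrr.
- have muE : mu = k + 1 / 2 by apply/eqP; rewrite -subr_eq0 -botE; apply/eqP; ring.
  apply: (pick 1%N) => //=.
  by rewrite (cE _ topE) muE; congr (_, _); field.
- have muE : mu = k + 3 / 2 by apply/eqP; rewrite -subr_eq0 -botE; apply/eqP; ring.
  apply: (pick 3%N) => //=.
  by rewrite (cE _ topE) muE; congr (_, _); field.
- have muE : mu = k - 1 / 2 by apply/eqP; rewrite -subr_eq0 -topE; apply/eqP; ring.
  apply: (pick 2%N) => //=.
  by rewrite (cE _ botE) muE; congr (_, _); field.
- by apply: (absurd 0); rewrite -{1}topE -botE; field.
- by apply: (absurd 1); rewrite -{1}topE -botE; field.
- have muE : mu = k - 3 / 2 by apply/eqP; rewrite -subr_eq0 -topE; apply/eqP; ring.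
  apply: (pick 4%N) => //=.
  by rewrite (cE _ botE) muE; congr (_, _); field.
- by apply: (absurd 1); rewrite -{1}topE -botE; field.
- by apply: (absurd 2); rewrite -{1}topE -botE; field.
Qed.

Local Notation param i := (tnth (one_dim_params k) i).

Lemma params_roots (i : 'I_5) :
  top_weight k (param i).1 (param i).2 /\ bottom_weight k (param i).1 (param i).2.
Proof.
rewrite /top_weight /bottom_weight; case: i => [[|[|[|[|[|i]]]]] //= lti].
all: by split; field.
Qed.

(** Half-integers with explicit numerators reduce comparisons of weights to
    comparisons of integers. *)
Lemma param_weight (i : 'I_5) : i != 0 ->
  (param i).2 = k + (nth 0 [:: 0; 1; -1; 3; -3] i : int)%:~R / 2.
Proof.
case: i => [[|[|[|[|[|i]]]]] //= lti] _; rewrite /=.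
all: by rewrite rmorphN /= mulNr.
Qed.

Lemma param_weight_inj (i j : 'I_5) : i != 0 -> j != 0 ->
  (param i).2 = (param j).2 -> i = j.
Proof.
move=> i0 j0; rewrite !param_weight // => /addrI.
move/(mulIf (invr_neq0 two_neq0))/intr_inj => zij; apply/val_inj; move: zij.
by case: i i0 => [[|[|[|[|[|i]]]]] //= lti] _; case: j j0 => [[|[|[|[|[|j]]]]] //= ltj] _.
Qed.

(** At weight 0 the Casimir value becomes (+-1)^2 - 1 = 0. *)
Lemma param_weight0 (i : 'I_5) : (param i).2 = 0 -> param i = (0, 0).
Proof.
case: i => [[|[|[|[|[|i]]]]] //= lti]; rewrite /= => w0.
all: by congr (_, _) => //; move/eqP: w0; rewrite ?addr_eq0 ?subr_eq0 => /eqP ->; field.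
Qed.

Lemma exists_param_weight0 : k \in [:: 1 / 2; - (1 / 2); 3 / 2; - (3 / 2)] <->
  exists2 i : 'I_5, i != 0 & (param i).2 = 0.
Proof.
rewrite !inE; split.
  case/or4P => /eqP ->.
  - by exists (Ordinal (isT : 2 < 5)%N) => //=; field.
  - by exists (Ordinal (isT : 1 < 5)%N) => //=; field.
  - by exists (Ordinal (isT : 4 < 5)%N) => //=; field.
  - by exists (Ordinal (isT : 3 < 5)%N) => //=; field.
case; case=> [[|[|[|[|[|i]]]]] //= lti] _; rewrite /= => /eqP.
all: by rewrite addr_eq0 ?opprK => /eqP ->; rewrite eqxx ?orbT.
Qed.

End Characters.

Theorem corollary6p7 (R : realType) (k : R[i]) :
  exists chi : 'I_5 -> {lrmorphism DJ k -> R[i]^o},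
  [/\ forall (i : 'I_5) (V : representation (DJ k)),
        is_Vk_param i V <-> equivalent V (character_rep (chi i)),
      forall (c lam : R[i]) (V : representation (DJ k)), is_Vk c lam V ->
        (one_dimensional V <-> exists i : 'I_5, is_Vk_param i V),
      k \notin [:: 1 / 2; - (1 / 2); 3 / 2; - (3 / 2)] ->
        forall i j : 'I_5, chi i =1 chi j -> i = j
    & k \in [:: 1 / 2; - (1 / 2); 3 / 2; - (3 / 2)] ->
        exists i0 j0 : 'I_5,
        [/\ i0 != j0, chi i0 =1 chi j0
          & forall i j : 'I_5, i != j -> chi i =1 chi j ->
              (i, j) \in [:: (i0, j0); (j0, i0)]]].
Proof.
have chi_ex (i : 'I_5) : exists chi : {lrmorphism DJ k -> R[i]^o},
    chi (calC k) = (tnth (one_dim_params k) i).1 /\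
    chi (Dh k) = (tnth (one_dim_params k) i).2.
  by have [top bot] := params_roots k i; exact: exists_character.
have [chi chiP] := choice chi_ex.
have chiE i V : is_Vk_param i V <-> equivalent V (character_rep (chi i)).
  have [top bot] := params_roots k i; have [chiC chih] := chiP i.
  rewrite character_rep_equivalent; split; first exact: is_Vk_acts_through.
  by case; exact: acts_through_is_Vk.
have eq_weight (i j : 'I_5) : chi i =1 chi j ->
    (tnth (one_dim_params k) i).2 = (tnth (one_dim_params k) j).2.
  by move=> /(_ (Dh k)); rewrite (chiP i).2 (chiP j).2.
have w0 (j : 'I_5) : chi ord0 =1 chi j -> (tnth (one_dim_params k) j).2 = 0.
  by move/eq_weight/esym.
have nz (i j : 'I_5) : i != j -> chi i =1 chi j -> (i == ord0) || (j == ord0).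
  move=> ij eqij; apply/norP => -[i0 j0].
  by case/eqP: ij; apply: (param_weight_inj i0 j0); exact: eq_weight.
exists chi; split=> [//|c lam V VV|k_gen i j eqij|].
- split=> [oneV|[i /chiE/character_rep_equivalent[]//]].
  have [mu [top bot VV']] := one_dimensional_roots VV oneV.
  have [i iE] := roots_params top bot; exists i.
  by rewrite /is_Vk_param iE.
- apply/eqP; apply: contraNT k_gen => ij; apply/exists_param_weight0.
  case/orP: (nz _ _ ij eqij) => /eqP E; subst.
    by exists j; [rewrite eq_sym|exact: w0].
  by exists i => //; apply: w0 => x; rewrite eqij.
move=> /exists_param_weight0[j0 j0_neq0 j0w]; exists ord0, j0; split.
- by rewrite eq_sym.
- apply: character_ext; rewrite ?(chiP _).1 ?(chiP _).2; last by rewrite j0w.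
  by rewrite (param_weight0 j0w).
move=> i j ij eqij; rewrite !inE !xpair_eqE.
case/orP: (nz _ _ ij eqij) => /eqP E; subst; rewrite eqxx /=.
  apply/orP; left; apply/eqP/(param_weight_inj (k := k)) => //.
    by rewrite eq_sym.
  by rewrite j0w; exact: w0.
apply/orP; right; rewrite andbT; apply/eqP/(param_weight_inj (k := k)) => //.
by rewrite j0w; apply: w0 => x; rewrite eqij.
Qed.
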